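(* Unless ETH is false, there is no algorithm that, given a propositional abduction problem $P=(V,H,M,T)$ whose theory $T$ has $n$ variables and primal treewidth $k$, decides solvability of $P$ in time $2^{2^{o(k)}}2^{o(n)}$. The same is true for deciding relevance of a variable $h\in H$ and for deciding necessity of a variable $h\in H$.
   Context: The Exponential Time Hypothesis (ETH) states that there is no algorithm for 3SAT with runtime $2^{o(N)}$, where $N$ is the number of variables of the input formula. A propositional abduction problem (PAP) is a tuple $P=(V,H,M,T)$ where $T$ is a CNF-formula (the theory) in the variables $V$, $M\subseteq V$ is the set of manifestations and $H\subseteq V$ is the set of hypotheses. A set $S\subseteq V$ is identified with the formula $\bigwedge_{x\in S}x$, and for $S\subseteq H$ one writes $T\cup S:=T\land\bigwedge_{x\in S}x$. A set $S\subseteq H$ is a solution of $P$ if $T\cup S$ is consistent (satisfiable) and $T\cup S\models M$, i.e., all models of $T\cup S$ are models of $M$. Solvability: given $P$, does it have a solution? Relevance: given $P$ and $h\in H$, is $h$ contained in at least one solution? Necessity: given $P$ and $h\in H$, is $h$ contained in all solutions? The primal graph of a CNF-formula has the variables as vertices, two of them being adjacent iff they appear together in a clause; the primal treewidth is the treewidth of the primal graph. *)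

(* Defs.v *)
From HB Require Import structures.
From mathcomp Require Import all_boot all_order all_algebra.
From mathcomp Require Import all_classical all_reals all_analysis.
Set Implicit Arguments.
Unset Strict Implicit.
Unset Printing Implicit Defensive.
Import Order.TTheory GRing.Theory Num.Theory.
Import numFieldNormedType.Exports.

(** * Algorithms and running time

    Algorithms are programs of the WHILE language of N. D. Jones
    ("Computability and Complexity from a Programming Perspective", MIT Press
    1997): imperative programs whose registers hold binary trees.  A step
    inspects or allocates boundedly many cells (no operation compares or copies
    whole trees), so the number of steps agrees with the running time of
    (multitape) Turing machines up to a polynomial.  The functions 2^o(N) and
    2^2^o(k) 2^o(n) are insensitive to such a change, also counting the
    polynomial in the input length, see [cnf_wf]. *)

Inductive tree := Leaf | Node of tree & tree.

Inductive expr :=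
  | Var of nat
  | Nil
  | Cons of expr & expr
  | Hd of expr
  | Tl of expr.

Inductive cmd :=
  | Skip
  | Assign of nat & expr
  | Seq of cmd & cmd
  | If of expr & cmd & cmd
  | While of expr & cmd.

Definition store := nat -> tree.

Definition tree_hd (t : tree) : tree := if t is Node a _ then a else Leaf.
Definition tree_tl (t : tree) : tree := if t is Node _ b then b else Leaf.
Definition is_true_tree (t : tree) : bool := if t is Node _ _ then true else false.

Fixpoint eval (s : store) (e : expr) : tree :=
  match e with
  | Var x => s x
  | Nil => Leaf
  | Cons a b => Node (eval s a) (eval s b)
  | Hd a => tree_hd (eval s a)
  | Tl a => tree_tl (eval s a)
  end.

Fixpoint expr_cost (e : expr) : nat :=
  match e with
  | Var _ | Nil => 1
  | Cons a b => (expr_cost a + expr_cost b).+1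
  | Hd a | Tl a => (expr_cost a).+1
  end.

Definition update (s : store) (x : nat) (v : tree) : store :=
  fun y => if y == x then v else s y.

(** [exec c s t s']: started in [s], [c] halts in [s'] after [t] steps. *)
Inductive exec : cmd -> store -> nat -> store -> Prop :=
  | ExecSkip s : exec Skip s 1 s
  | ExecAssign s x e :
      exec (Assign x e) s (expr_cost e).+1 (update s x (eval s e))
  | ExecSeq c1 c2 s1 s2 s3 t1 t2 :
      exec c1 s1 t1 s2 -> exec c2 s2 t2 s3 ->
      exec (Seq c1 c2) s1 (t1 + t2).+1 s3
  | ExecIf e c1 c2 s s' t :
      exec (if is_true_tree (eval s e) then c1 else c2) s t s' ->
      exec (If e c1 c2) s (expr_cost e + t).+1 s'
  | ExecWhileFalse e c s :
      ~~ is_true_tree (eval s e) ->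
      exec (While e c) s (expr_cost e).+1 s
  | ExecWhileTrue e c s1 s2 s3 t1 t2 :
      is_true_tree (eval s1 e) ->
      exec c s1 t1 s2 -> exec (While e c) s2 t2 s3 ->
      exec (While e c) s1 (expr_cost e + t1 + t2).+1 s3.

(** The input is in register 0 (all others hold [Leaf]), and so is the answer. *)
Definition input_store (v : tree) : store := fun x => if x == 0 then v else Leaf.

Definition decides_in_time (R : realType) (I : Type) (enc : I -> tree)
    (yes : I -> Prop) (bound : I -> R) (c : cmd) : Prop :=
  forall x : I, exists (t : nat) (s : store),
    [/\ exec c (input_store (enc x)) t s,
        is_true_tree (s 0) <-> yes x
      & (t%:R <= bound x)%R].

(** * Encoding of data as trees *)

Definition enc_bool (b : bool) : tree := if b then Node Leaf Leaf else Leaf.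

Definition enc_seq (T : Type) (enc : T -> tree) (s : seq T) : tree :=
  foldr (fun x t => Node (enc x) t) Leaf s.

(** Numbers in binary, as lists of bits, least significant bit first. *)
Fixpoint enc_pos (p : BinNums.positive) : tree :=
  match p with
  | BinNums.xH => Node (enc_bool true) Leaf
  | BinNums.xO q => Node (enc_bool false) (enc_pos q)
  | BinNums.xI q => Node (enc_bool true) (enc_pos q)
  end.

Definition enc_nat (n : nat) : tree :=
  match bin_of_nat n with
  | BinNums.N0 => Leaf
  | BinNums.Npos p => enc_pos p
  end.

Definition enc_ord (n : nat) (i : 'I_n) : tree := enc_nat i.

Definition enc_set (n : nat) (A : {set 'I_n}) : tree :=
  enc_seq (@enc_ord n) (enum A).

(** * CNF-formulas in the variables 'I_n *)

Definition literal (n : nat) := ('I_n * bool)%type.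
Definition clause (n : nat) := seq (literal n).
Definition cnf (n : nat) := seq (clause n).

(** Clauses are sets of literals and formulas are sets of clauses, listed
    without repetition in any order.  Without this requirement the length of a
    formula would not be bounded by a function of its number of variables, and
    no algorithm could meet a time bound depending on the latter only.  With it,
    a 3CNF in N variables has length N^O(1), and a CNF in n variables of primal
    treewidth k has length n^O(1) 2^O(k log k). *)
Definition cnf_wf (n : nat) (F : cnf n) : bool := uniq F && all uniq F.

Definition satisfies (n : nat) (a : {ffun 'I_n -> bool}) (F : cnf n) : bool :=
  all (has (fun l : literal n => a l.1 == l.2)) F.

Definition satisfiable (n : nat) (F : cnf n) : Prop :=
  exists a : {ffun 'I_n -> bool}, satisfies a F.

Definition entails (n : nat) (F G : cnf n) : Prop :=
  forall a : {ffun 'I_n -> bool}, satisfies a F -> satisfies a G.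

(** The formula /\_(x in S) x identified with the set S. *)
Definition conj_of (n : nat) (S : {set 'I_n}) : cnf n :=
  [seq [:: (x, true)] | x <- enum S].

Definition enc_literal (n : nat) (l : literal n) : tree :=
  Node (enc_ord l.1) (enc_bool l.2).

Definition enc_cnf (n : nat) (F : cnf n) : tree :=
  enc_seq (enc_seq (@enc_literal n)) F.

(** * 3SAT and the Exponential Time Hypothesis *)

Record cnf3 := Cnf3 {
  cnf3_nvars : nat;
  cnf3_cnf : cnf cnf3_nvars;
  _ : cnf_wf cnf3_cnf && all (fun C : clause cnf3_nvars => size C <= 3) cnf3_cnf
}.

Definition enc_cnf3 (F : cnf3) : tree :=
  Node (enc_set [set: 'I_(cnf3_nvars F)]) (enc_cnf (cnf3_cnf F)).

Definition sat3 (F : cnf3) : Prop := satisfiable (cnf3_cnf F).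

Definition little_o_id (R : realType) (f : nat -> R) : Prop :=
  ((f : nat -> R^o) =o_\oo (fun n => n%:R%R : R^o))%classic.

Definition ETH (R : realType) : Prop :=
  ~ exists (c : cmd) (f : nat -> R),
      little_o_id f /\
      decides_in_time enc_cnf3 sat3 (fun F => 2 `^ f (cnf3_nvars F))%R c.

(** * Treewidth *)

(** A (simple, undirected) graph is given by its adjacency relation.  In a
    symmetric relation, cycles of length at most 2 are not graph cycles. *)
Definition is_tree (I : finType) (e : rel I) : Prop :=
  [/\ symmetric e, irreflexive e, 0 < #|I|,
      forall x y : I, connect e x y
    & forall s : seq I, ucycle e s -> size s <= 2].

Definition is_tree_decomposition (V : finType) (adj : rel V)
    (I : finType) (e : rel I) (bag : I -> {set V}) : Prop :=
  [/\ is_tree e,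
      forall v : V, exists i : I, v \in bag i,
      forall u v : V, adj u v -> exists i : I, (u \in bag i) && (v \in bag i)
    & forall (v : V) (i j : I), v \in bag i -> v \in bag j ->
        connect (fun x y => [&& e x y, v \in bag x & v \in bag y]) i j].

(** The width of a decomposition is the maximal size of a bag minus one. *)
Definition has_tree_decomposition (V : finType) (adj : rel V) (w : nat) : Prop :=
  exists (I : finType) (e : rel I) (bag : I -> {set V}),
    is_tree_decomposition adj e bag /\ forall i : I, #|bag i| <= w.+1.

Lemma tree_decomposition_exists (V : finType) (adj : rel V) :
  exists w : nat, `[< has_tree_decomposition adj w >].
Proof.
exists #|V|; apply/asboolP.
exists unit, (fun _ _ => false), (fun=> [set: V]); split; last first.
  by move=> _; rewrite cardsT.
split=> [|v|u v _|v [] [] _ _].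
- split=> //; first by rewrite card_unit.
  + by move=> [] [].
  + by move=> [|x [|y s]].
- by exists tt; rewrite inE.
- by exists tt; rewrite !inE.
- exact: connect0.
Qed.

(** The graph without vertices gets treewidth 0. *)
Definition treewidth (V : finType) (adj : rel V) : nat :=
  ex_minn (tree_decomposition_exists adj).

Definition primal_graph (n : nat) (F : cnf n) : rel 'I_n := fun i j =>
  (i != j) && has (fun C => (i \in unzip1 C) && (j \in unzip1 C)) F.

Definition primal_treewidth (n : nat) (F : cnf n) : nat :=
  treewidth (primal_graph F).

(** * Propositional abduction *)

(** The set of variables V is 'I_(pap_nvars P). *)
Record pap := Pap {
  pap_nvars : nat;
  pap_H : {set 'I_pap_nvars};
  pap_M : {set 'I_pap_nvars};
  pap_T : cnf pap_nvars;
  _ : cnf_wf pap_T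
}.

Definition pap_tw (P : pap) : nat := primal_treewidth (pap_T P).

Definition is_solution (P : pap) (S : {set 'I_(pap_nvars P)}) : Prop :=
  [/\ S \subset pap_H P,
      satisfiable (pap_T P ++ conj_of S)
    & entails (pap_T P ++ conj_of S) (conj_of (pap_M P))].

Definition solvable_pap (P : pap) : Prop :=
  exists S : {set 'I_(pap_nvars P)}, is_solution S.

Record pap_hyp := PapHyp {
  ph_pap : pap;
  ph_var : 'I_(pap_nvars ph_pap);
  _ : ph_var \in pap_H ph_pap
}.

Definition relevant (x : pap_hyp) : Prop :=
  exists S : {set 'I_(pap_nvars (ph_pap x))}, is_solution S /\ ph_var x \in S.

Definition necessary (x : pap_hyp) : Prop :=
  forall S : {set 'I_(pap_nvars (ph_pap x))}, is_solution S -> ph_var x \in S.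

Definition enc_pap (P : pap) : tree :=
  Node (enc_set [set: 'I_(pap_nvars P)])
    (Node (enc_set (pap_H P)) (Node (enc_set (pap_M P)) (enc_cnf (pap_T P)))).

Definition enc_pap_hyp (x : pap_hyp) : tree :=
  Node (enc_pap (ph_pap x)) (enc_ord (ph_var x)).

Definition pap_time (R : realType) (f g : nat -> R) (P : pap) : R :=
  (2 `^ (2 `^ f (pap_tw P)) * 2 `^ g (pap_nvars P))%R.

(* Main.v *)
(** A 3CNF with clauses [C_0, ..., C_(m-1)] in [N] variables is turned into an
    abduction problem with [O(N)] variables and treewidth [O(log N)]; then
    [2^(2^o(k)) 2^o(n) = 2^o(N)].  A solution is a set of asserted literals
    without conflicts, and the universal quantifier in "[T] and [S] entail [M]"
    selects the clause to be checked: [O(log m) = O(log N)] addressing variables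
    spell a leaf of a binary tree with the clauses at its leaves, and below the
    path to [C_i] the theory derives the manifestation from each asserted literal
    of [C_i].  Apart from the addressing variables and the manifestation, a
    clause of the theory mentions the two literals of one variable only.  An
    unconstrained hypothesis turns solvability into relevance, and unsolvability
    into necessity. *)
From mathcomp Require Import all_boot all_order all_algebra.
From mathcomp Require Import all_classical all_reals all_analysis.
From mathcomp Require Import zify ring lra.
Require Import Defs.
Set Implicit Arguments.
Unset Strict Implicit.
Unset Printing Implicit Defensive.
Import Order.TTheory GRing.Theory Num.Theory.
Import numFieldNormedType.Exports.

(** * Programs computing functions in polynomial time *)

(** The reduction has to be an actual WHILE program whose output is, cell for cell, the tree that
    encodes the instance. It therefore computes on lists of natural numbers instead of ordinals,
    emits sets in increasing order, and is assembled from folds with a polynomial size bound on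
    every intermediate result. The addressing tree is grown from its leaves, with one fresh variable
    per round: a round neither copies nor drops a clause, which keeps sizes polynomial, and an
    unpaired block moves on without a bit, so that every address leads to some leaf.

    Without the addressing variables in use and the manifestation, every clause lives in the 16
    slots of a single variable; a star of bags then has width at most [rounds F + 16]. All that the
    time bound needs from this is that [2 ^ k] is polynomial in [N].

    On the analytic side, ETH asks for one little-o function, whereas sums, products and
    substitutions are handled more easily by a bound for each [eps]. The computation stays in the
    second form until a lower envelope converts it back. *)

Definition poly_bounded (p : nat -> nat) : Prop :=
  exists k, forall X, 1 < X -> p X <= X ^ k.

Lemma poly_bounded_id : poly_bounded id.
Proof. by exists 1 => X _; rewrite expn1. Qed.

Lemma poly_bounded_const c : poly_bounded (fun=> c).
Proof.
exists c => X X1; apply: (leq_trans (ltnW (ltn_expl c (isT : 1 < 2)))).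
by case: c => // c; rewrite leq_exp2r.
Qed.

Lemma poly_bounded_exp k : poly_bounded (fun X => X ^ k).
Proof. by exists k. Qed.

Lemma poly_bounded_mul p q :
  poly_bounded p -> poly_bounded q -> poly_bounded (fun X => p X * q X).
Proof.
move=> [k hp] [l hq]; exists (k + l) => X X1.
by rewrite expnD leq_mul ?hp ?hq.
Qed.

Lemma poly_bounded_add p q :
  poly_bounded p -> poly_bounded q -> poly_bounded (fun X => p X + q X).
Proof.
move=> [k hp] [l hq]; exists (k + l).+1 => X X1.
have X0 : 0 < X by exact: ltnW.
rewrite expnS; apply: leq_trans (leq_mul X1 (leqnn _)).
rewrite mul2n -addnn leq_add //.
- by apply: leq_trans (hp _ X1) _; rewrite leq_pexp2l // leq_addr.
- by apply: leq_trans (hq _ X1) _; rewrite leq_pexp2l // leq_addl.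
Qed.

Lemma poly_bounded_comp_exp p k :
  poly_bounded p -> poly_bounded (fun X => (p X) ^ k).
Proof.
move=> [l hp]; exists (l * k) => X X1; rewrite expnM.
by case: k => // k; rewrite leq_exp2r ?hp.
Qed.

Ltac poly_bounded := repeat first
  [ exact: poly_bounded_id | exact: poly_bounded_const
  | exact: poly_bounded_exp | apply: poly_bounded_add
  | apply: poly_bounded_mul | apply: poly_bounded_comp_exp ].

(** A Hoare triple with a time bound. Only an upper bound on the steps is kept, so that the branches
    of a conditional and the turns of a loop can share one estimate. *)
Definition run (c : cmd) (s : store) (T : nat) (P : store -> Prop) : Prop :=
  exists t s', [/\ exec c s t s', t <= T & P s'].

Lemma run_weaken c s T T' (P P' : store -> Prop) :
  run c s T P -> T <= T' -> (forall s', P s' -> P' s') -> run c s T' P'.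
Proof.
move=> [t [s' [ex le_t Ps']]] leT PP'; exists t, s'; split=> //.
- exact: leq_trans leT.
- exact: PP'.
Qed.

Lemma run_assign x e s (P : store -> Prop) :
  P (update s x (eval s e)) -> run (Assign x e) s (expr_cost e).+1 P.
Proof. by move=> Ps; do 2![eexists]; split; [exact: ExecAssign| |]. Qed.

Lemma run_seq c1 c2 s T1 T2 (P Q : store -> Prop) :
  run c1 s T1 P -> (forall s1, P s1 -> run c2 s1 T2 Q) ->
  run (Seq c1 c2) s (T1 + T2).+1 Q.
Proof.
move=> [t1 [s1 [ex1 le1 Ps1]]] /(_ _ Ps1) [t2 [s2 [ex2 le2 Qs2]]].
exists (t1 + t2).+1, s2; split=> //; first exact: ExecSeq ex1 ex2.
by rewrite ltnS leq_add.
Qed.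

Lemma run_assign_seq x e c s T (Q : store -> Prop) :
  run c (update s x (eval s e)) T Q ->
  run (Seq (Assign x e) c) s ((expr_cost e).+1 + T).+1 Q.
Proof.
move=> h; apply: (run_seq (P := fun s' => s' = update s x (eval s e))).
  exact: run_assign.
by move=> _ ->.
Qed.

Lemma run_if e c1 c2 s T (P : store -> Prop) :
  run (if is_true_tree (eval s e) then c1 else c2) s T P ->
  run (If e c1 c2) s (expr_cost e + T).+1 P.
Proof.
move=> [t [s' [ex le_t Ps']]]; exists (expr_cost e + t).+1, s'; split=> //.
- exact: ExecIf.
- by rewrite ltnS leq_add2l.
Qed.

(** A leaf counts 2, so every size exceeds 1 and a power of the size absorbs constants and sums; one
    exponent can then bound both time and output. *)
Fixpoint tsize (t : tree) : nat :=
  if t is Node a b then tsize a + tsize b else 2.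

Lemma tsize_gt1 t : 1 < tsize t.
Proof. by elim: t => //= a ha b hb; lia. Qed.

Section Polytime.

Definition enc_pair (A B : Type) (eA : A -> tree) (eB : B -> tree)
  (p : A * B) : tree := Node (eA p.1) (eB p.2).

(** The function is computed in place in register [d], for every [d], by a
    program that leaves the registers below [d] alone and assumes nothing about
    the ones above: this makes such programs composable. *)
Definition polytime (A B : Type) (eA : A -> tree) (eB : B -> tree)
    (f : A -> B) : Prop :=
  exists k,
    (forall x, tsize (eB (f x)) <= tsize (eA x) ^ k) /\
    forall d, exists c, forall s x, s d = eA x ->
      run c s (tsize (eA x) ^ k)
        (fun s' => s' d = eB (f x) /\ forall y, y < d -> s' y = s y).

Lemma polytime_intro (A B : Type) (eA : A -> tree) (eB : B -> tree)
    (f : A -> B) (p q : nat -> nat) :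
  poly_bounded p -> poly_bounded q ->
  (forall x, tsize (eB (f x)) <= p (tsize (eA x))) ->
  (forall d, exists c, forall s x, s d = eA x ->
      run c s (q (tsize (eA x)))
        (fun s' => s' d = eB (f x) /\ forall y, y < d -> s' y = s y)) ->
  polytime eA eB f.
Proof.
move=> [k hp] [l hq] hsz hc; exists (k + l); split=> [x|d].
- apply: leq_trans (hsz x) _; apply: leq_trans (hp _ (tsize_gt1 _)) _.
  by rewrite leq_pexp2l ?leq_addr // ltnW // tsize_gt1.
- have [c {}hc] := hc d; exists c => s x sx.
  apply: run_weaken (hc _ _ sx) _ _ => //.
  apply: leq_trans (hq _ (tsize_gt1 _)) _.
  by rewrite leq_pexp2l ?leq_addl // ltnW // tsize_gt1.
Qed.

Variables (A B C : Type) (eA : A -> tree) (eB : B -> tree) (eC : C -> tree).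

Lemma eq_polytime (f g : A -> B) :
  f =1 g -> polytime eA eB f -> polytime eA eB g.
Proof. by move=> /funext ->. Qed.

Lemma polytime_expr (f : A -> B) (e : nat -> expr) (n : nat) :
  (forall d s x, s d = eA x -> eval s (e d) = eB (f x)) ->
  (forall d, expr_cost (e d) <= n) ->
  (forall x, tsize (eB (f x)) <= tsize (eA x) + n) ->
  polytime eA eB f.
Proof.
move=> he hn hsz.
apply: (polytime_intro (p := fun X => X + n) (q := fun=> n.+1)) => //.
- by poly_bounded.
- by poly_bounded.
move=> d; exists (Assign d (e d)) => s x sx.
set P := fun s' => _.
apply: (run_weaken (P := P) (run_assign _)) => //; last by rewrite ltnS hn.
rewrite /P /update eqxx (he _ _ x) //; split=> // y yd.
by rewrite ltn_eqF.
Qed.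

Lemma polytime_cast (f : A -> B) :
  (forall x, eB (f x) = eA x) -> polytime eA eB f.
Proof.
move=> h; apply: (polytime_expr (e := Var) (n := 1)) => [d s x /= ->|//|x].
- by rewrite h.
- by rewrite h leq_addr.
Qed.

Lemma polytime_comp (g : B -> C) (f : A -> B) :
  polytime eA eB f -> polytime eB eC g -> polytime eA eC (g \o f).
Proof.
move=> [k [fsz hf]] [l [gsz hg]].
have le_g x : tsize (eB (f x)) ^ l <= (tsize (eA x) ^ k) ^ l.
  by case: (l) => // l'; rewrite leq_exp2r.
apply: (polytime_intro (p := fun X => (X ^ k) ^ l)
  (q := fun X => X ^ k + (X ^ k) ^ l + 1)).
- by poly_bounded.
- by poly_bounded.
- by move=> x; apply: leq_trans (gsz _) _.
move=> d; have [c1 h1] := hf d; have [c2 h2] := hg d.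
exists (Seq c1 c2) => s x sx; rewrite addn1.
apply: run_seq (h1 _ _ sx) _ => s1 [s1d s1y].
apply: run_weaken (h2 _ _ s1d) (le_g x) _ => s2 [s2d s2y].
by split=> // y yd; rewrite s2y // s1y.
Qed.

Lemma polytime_pair (f : A -> B) (g : A -> C) :
  polytime eA eB f -> polytime eA eC g ->
  polytime eA (enc_pair eB eC) (fun x => (f x, g x)).
Proof.
move=> [k [fsz hf]] [l [gsz hg]].
apply: (polytime_intro (p := fun X => X ^ k + X ^ l)
  (q := fun X => X ^ k + X ^ l + 12)).
- by poly_bounded.
- by poly_bounded.
- by move=> x /=; apply: leq_add.
move=> d; have [c1 h1] := hf d.+1; have [c2 h2] := hg d.+2.
(* [c1] works in register [d.+1] and spares the input in [d]; [c2] works in [d.+2] and spares both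
   the input and the first result. *)
exists (Seq (Assign d.+1 (Var d)) (Seq c1 (Seq (Assign d.+2 (Var d))
  (Seq c2 (Assign d (Cons (Var d.+1) (Var d.+2))))))) => s x sx.
set P := fun s' => _.
apply: (run_weaken (P := P) (T := (2 + (tsize (eA x) ^ k +
  (2 + (tsize (eA x) ^ l + 4).+1).+1).+1).+1)) => //; last by lia.
apply: run_assign_seq => /=.
apply: (run_seq (h1 _ x _)); first by rewrite /update eqxx.
move=> s1 [s1d s1y]; apply: run_assign_seq => /=.
have s1y' y : y <= d -> s1 y = s y.
  by move=> yd; rewrite s1y ?ltnS // /update ltn_eqF.
apply: (run_seq (h2 _ x _)); first by rewrite /update eqxx s1y'.
move=> s2 [s2d s2y]; apply: run_assign => /=.
rewrite /P {1}/update eqxx s2d s2y // /update ltn_eqF // s1d; split=> // y yd.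
rewrite ltn_eqF // s2y; last by lia.
by rewrite /update ltn_eqF ?s1y' //; lia.
Qed.

End Polytime.

Section PolytimeBasic.
Variables (A B : Type) (eA : A -> tree) (eB : B -> tree).

Lemma polytime_fst : polytime (enc_pair eA eB) eA fst.
Proof.
by apply: (polytime_expr (e := Hd \o Var) (n := 2)) => [d s x /= ->|//|x] //=; lia.
Qed.

Lemma polytime_snd : polytime (enc_pair eA eB) eB snd.
Proof.
by apply: (polytime_expr (e := Tl \o Var) (n := 2)) => [d s x /= ->|//|x] //=; lia.
Qed.

Fixpoint quote_tree (t : tree) : expr :=
  if t is Node a b then Cons (quote_tree a) (quote_tree b) else Nil.

Lemma polytime_const (b : B) : polytime eA eB (fun=> b).
Proof.
apply: (polytime_expr (e := fun=> quote_tree (eB b))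
  (n := expr_cost (quote_tree (eB b)) + tsize (eB b))) => [d s x _|d|x].
- by elim: (eB b) => //= t1 -> t2 ->.
- exact: leq_addr.
- by lia.
Qed.

Lemma polytime_if (p : A -> bool) (f g : A -> B) :
  polytime eA enc_bool p -> polytime eA eB f -> polytime eA eB g ->
  polytime eA eB (fun x => if p x then f x else g x).
Proof.
move=> [m [psz hp]] [k [fsz hf]] [l [gsz hg]].
apply: (polytime_intro (p := fun X => X ^ k + X ^ l)
  (q := fun X => X ^ m + (X ^ k + X ^ l) + 12)).
- by poly_bounded.
- by poly_bounded.
- by move=> x; case: (p x); [apply: leq_trans (fsz x) _; lia
                             |apply: leq_trans (gsz x) _; lia].
move=> d; have [c0 h0] := hp d.+1.
have [c1 h1] := hf d; have [c2 h2] := hg d.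
exists (Seq (Assign d.+1 (Var d)) (Seq c0 (If (Var d.+1) c1 c2))) => s x sx.
set P := fun s' => _.
apply: (run_weaken (P := P) (T := (2 + (tsize (eA x) ^ m +
  (1 + (tsize (eA x) ^ k + tsize (eA x) ^ l)).+1).+1).+1)) => //; last by lia.
apply: run_assign_seq => /=.
apply: (run_seq (h0 _ x _)); first by rewrite /update eqxx.
move=> s1 [s1d s1y]; apply: run_if => /=.
have s1y' y : y <= d -> s1 y = s y.
  by move=> yd; rewrite s1y ?ltnS // /update ltn_eqF.
rewrite s1d; have s1x : s1 d = eA x by rewrite s1y'.
rewrite /P; case: (p x) => /=.
- apply: run_weaken (h1 _ _ s1x) (leq_addr _ _) _ => s2 [s2d s2y].
  by split=> // y yd; rewrite s2y // s1y' // ltnW.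
- apply: run_weaken (h2 _ _ s1x) (leq_addl _ _) _ => s2 [s2d s2y].
  by split=> // y yd; rewrite s2y // s1y' // ltnW.
Qed.

End PolytimeBasic.

(** * List programs obtained by folding *)

Section PolytimeSeq.
Variables (A B E : Type) (eA : A -> tree) (eB : B -> tree) (eE : E -> tree).

Lemma tsize_enc_cat (T : Type) (eT : T -> tree) (s1 s2 : seq T) :
  tsize (enc_seq eT (s1 ++ s2)) + 2
  = tsize (enc_seq eT s1) + tsize (enc_seq eT s2).
Proof. by elim: s1 => [|a s1 ih] //=; lia. Qed.

Lemma size_le_tsize (T : Type) (eT : T -> tree) (s : seq T) :
  (size s).*2 < tsize (enc_seq eT s).
Proof.
elim: s => //= a s ih; have := tsize_gt1 (eT a); rewrite doubleS; lia.
Qed.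

(** Register [d] keeps the environment, [d.+1] the rest of the list and [d.+2] the accumulator;
    [d.+3] passes the argument to [c] and receives its result. *)
Let loop_body d c :=
  Seq (Assign d.+3 (Cons (Var d) (Cons (Var d.+2) (Hd (Var d.+1)))))
    (Seq c (Seq (Assign d.+2 (Var d.+3)) (Assign d.+1 (Tl (Var d.+1))))).

Lemma run_foldl_loop (f : E * (B * A) -> B) d c k M (s : store) e b l :
  (forall s x, s d.+3 = enc_pair eE (enc_pair eB eA) x ->
    run c s (tsize (enc_pair eE (enc_pair eB eA) x) ^ k)
      (fun s' => s' d.+3 = eB (f x) /\ forall y, y < d.+3 -> s' y = s y)) ->
  (forall l1 a l2, l = l1 ++ a :: l2 ->
    tsize (enc_pair eE (enc_pair eB eA)
      (e, (foldl (fun b a => f (e, (b, a))) b l1, a))) <= M) ->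
  s d = eE e -> s d.+1 = enc_seq eA l -> s d.+2 = eB b ->
  run (While (Var d.+1) (loop_body d c)) s (size l * (M ^ k + 20) + 2)
    (fun s' => [/\ s' d.+2 = eB (foldl (fun b a => f (e, (b, a))) b l)
             & forall y, y < d -> s' y = s y]).
Proof.
move=> hc; elim: l b s => [|a l ih] b s hM sd sd1 sd2.
  exists 2, s; split=> //.
  by apply: (@ExecWhileFalse (Var d.+1)); rewrite /= sd1.
have hM0 : tsize (enc_pair eE (enc_pair eB eA) (e, (b, a))) <= M.
  exact: (hM [::] a l).
have hMk : tsize (enc_pair eE (enc_pair eB eA) (e, (b, a))) ^ k <= M ^ k.
  by case: (k) => // k'; rewrite leq_exp2r.
have [t [s1 [ex1 le1 [s1d s1d1 s1d2 s1y]]]] :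
    run (loop_body d c) s (M ^ k + 17) (fun s' =>
     [/\ s' d = eE e, s' d.+1 = enc_seq eA l, s' d.+2 = eB (f (e, (b, a)))
       & forall y, y < d -> s' y = s y]).
  rewrite /loop_body; set P := fun s' => _.
  apply: (run_weaken (P := P) (T := (7 + (M ^ k + (2 + 3).+1).+1).+1)) => //;
    last by lia.
  apply: run_assign_seq => /=.
  apply: (run_seq (P := fun s' => s' d.+3 = eB (f (e, (b, a))) /\
      forall y, y < d.+3 -> s' y = s y)).
    apply: run_weaken (hc _ (e, (b, a)) _) hMk _.
      by rewrite /update eqxx sd sd1 sd2.
    move=> s' [-> s'y]; split=> // y yd; rewrite s'y // /update ltn_eqF //.
  move=> s2 [s2d s2y]; apply: run_assign_seq => /=; apply: run_assign => /=.
  rewrite /P /update !eqxx; split.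
  + by rewrite !ltn_eqF ?s2y //; lia.
  + by rewrite ltn_eqF // s2y ?sd1 //; lia.
  + by rewrite gtn_eqF.
  + by move=> y yd; rewrite !ltn_eqF ?s2y //; lia.
have [|t' [s2 [ex2 le2 [s2d s2y]]]] := ih (f (e, (b, a))) s1 _ s1d s1d1 s1d2.
  by by move=> l1 a' l2 El; apply: (hM (a :: l1) a' l2); rewrite El.
exists (1 + t + t').+1, s2; split.
- by apply: (@ExecWhileTrue (Var d.+1)) ex1 ex2; rewrite /= sd1.
- by rewrite /= mulSn; lia.
- by split=> // y yd; rewrite s2y // s1y.
Qed.

(** The size hypothesis on the final result also bounds all intermediate
    results, as they are the final results on prefixes. *)
Lemma polytime_foldl (f : E * (B * A) -> B) (p : nat -> nat) :
  polytime (enc_pair eE (enc_pair eB eA)) eB f ->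
  poly_bounded p ->
  (forall e b l, tsize (eB (foldl (fun b a => f (e, (b, a))) b l))
     <= p (tsize (eE e) + (tsize (eB b) + tsize (enc_seq eA l)))) ->
  polytime (enc_pair eE (enc_pair eB (enc_seq eA))) eB
    (fun x => foldl (fun b a => f (x.1, (b, a))) x.2.1 x.2.2).
Proof.
move=> [k [_ hf]] [j hp] hsz.
(* The summands bound the environment, the accumulator and the list element in an argument of
   [f]. *)
pose M X := X + (X ^ j + X).
apply: (polytime_intro (p := fun X => X ^ j)
  (q := fun X => X * (M X ^ k + 20) + 32)).
- by poly_bounded.
- by rewrite /M; poly_bounded.
- move=> [e [b l]] /=; apply: leq_trans (hsz e b l) (hp _ _).
  by have := tsize_gt1 (eE e); lia.
move=> d; have [c hc] := hf d.+3.
exists (Seq (Assign d.+1 (Tl (Tl (Var d)))) (Seq (Assign d.+2 (Hd (Tl (Var d))))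
  (Seq (Assign d (Hd (Var d))) (Seq (While (Var d.+1) (loop_body d c))
  (Assign d (Var d.+2)))))) => s [e [b l]] sx.
set X := tsize _; set P := fun s' => _.
have eX : X = tsize (eE e) + (tsize (eB b) + tsize (enc_seq eA l)) by [].
apply: (run_weaken (P := P) (T := (4 + (4 + (3 +
  ((X * (M X ^ k + 20) + 2) + 2).+1).+1).+1).+1)) => //; last by lia.
apply: run_assign_seq => /=; apply: run_assign_seq => /=.
apply: run_assign_seq => /=.
set s0 := update _ _ _.
have s0y y : y < d -> s0 y = s y.
  by move=> yd; rewrite /s0 /update !ltn_eqF //; lia.
apply: (run_seq (P := fun s' => [/\
    s' d.+2 = eB (foldl (fun b a => f (e, (b, a))) b l)
  & forall y, y < d -> s' y = s0 y])).
  apply: (run_weaken (@run_foldl_loop f d c k (M X) s0 e b l hc _ _ _ _)) => //.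
  - move=> l1 a l2 El /=; rewrite /M.
    have := tsize_enc_cat eA l1 (a :: l2); rewrite -El /= => sz_l.
    have a1 := tsize_gt1 (eA a); have l21 := tsize_gt1 (enc_seq eA l2).
    apply: leq_add; first by lia.
    apply: leq_add; last by lia.
    have e1 := tsize_gt1 (eE e).
    apply: leq_trans (hsz e b l1) _; apply: leq_trans (hp _ _) _.
      by lia.
    by case: (j) => // j'; rewrite leq_exp2r //; lia.
  - by rewrite /s0 /update eqxx !ltn_eqF //= sx.
  - by rewrite /s0 /update /= gtn_eqF // ltn_eqF // eqxx sx.
  - by rewrite /s0 /update eqxx /= gtn_eqF // ltn_eqF // sx.
  - rewrite leq_add2r leq_mul //.
    by have := size_le_tsize eA l; have := tsize_gt1 (eE e); lia.
move=> s1 [s1d s1y]; apply: run_assign; rewrite /P /= /update eqxx.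
by split=> // y yd; rewrite ltn_eqF // s1y // s0y.
Qed.

End PolytimeSeq.

Lemma polytime_comp2 (A B C D : Type) (eA : A -> tree) (eB : B -> tree)
    (eC : C -> tree) (eD : D -> tree) (h : B * C -> D) (f : A -> B) (g : A -> C) :
  polytime eA eB f -> polytime eA eC g -> polytime (enc_pair eB eC) eD h ->
  polytime eA eD (fun x => h (f x, g x)).
Proof. by move=> hf hg; apply: polytime_comp; apply: polytime_pair. Qed.

Lemma polytime_test (A : Type) (eA : A -> tree) (p : A -> bool) :
  (forall x, p x = is_true_tree (eA x)) -> polytime eA enc_bool p.
Proof.
move=> hp; apply: (polytime_intro (p := fun=> 4) (q := fun=> 10)).
- by poly_bounded.
- by poly_bounded.
- by move=> x; case: (p x).
move=> d; exists (If (Var d) (Assign d (Cons Nil Nil)) (Assign d Nil)) => s x sx.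
set P := fun s' => _.
apply: (run_weaken (P := P) (T := (1 + 4).+1)) => //; apply: run_if => /=.
have hP v : v = enc_bool (p x) -> P (update s d v).
  by move=> ->; rewrite /P /update eqxx; split=> // y yd; rewrite ltn_eqF.
rewrite sx -hp; case: ifP => [|/negbT] px.
- by apply: run_assign; apply: hP; rewrite px.
- apply: run_weaken (run_assign (P := P) _) _ _ => //.
  by apply: hP; rewrite (negbTE px).
Qed.

Section PolytimeLists.
Variables (A B E : Type) (eA : A -> tree) (eB : B -> tree) (eE : E -> tree).

Lemma polytime_cons :
  polytime (enc_pair eA (enc_seq eA)) (enc_seq eA) (fun p => p.1 :: p.2).
Proof. exact: polytime_cast. Qed.

Lemma polytime_head x0 : eA x0 = Leaf -> polytime (enc_seq eA) eA (head x0).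
Proof.
move=> h; apply: (polytime_expr (e := Hd \o Var) (n := 2)) => [d s x /= ->|//|x].
- by case: x.
- by case: x => [|a x] /=; rewrite ?h //=; lia.
Qed.

Lemma polytime_rev : polytime (enc_seq eA) (enc_seq eA) rev.
Proof.
pose f (x : unit * (seq A * A)) := x.2.2 :: x.2.1.
have pf : polytime (enc_pair (fun=> Leaf) (enc_pair (enc_seq eA) eA))
    (enc_seq eA) f.
  apply: polytime_comp2 polytime_cons.
  - exact: polytime_comp (polytime_snd _ _) (polytime_snd _ _).
  - exact: polytime_comp (polytime_snd _ _) (polytime_fst _ _).
have pp : poly_bounded id by poly_bounded.
have := polytime_foldl pf pp.
move=> /(_ _)/wrap[|h].
  move=> e b l; elim: l b => [|a l ih] b /=; first by lia.
  by apply: leq_trans (ih _) _ => /=; lia.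
apply: (eq_polytime (f := fun s => foldl (fun b a => f (tt, (b, a))) [::] s)).
  move=> s; rewrite -[rev s]cats0 -/(catrev s [::]).
  by rewrite -catrevE; elim: s [::] => //= a s ih b; rewrite ih.
refine (polytime_comp2 (f := fun=> tt) (g := fun s => ([::], s)) _ _ h).
- exact: polytime_const.
- apply: polytime_pair; [exact: polytime_const|exact: polytime_cast].
Qed.

Lemma tsize_rev (s : seq A) : tsize (enc_seq eA (rev s)) = tsize (enc_seq eA s).
Proof.
elim: s => //= a s ih; rewrite rev_cons -cats1.
by have := tsize_enc_cat eA (rev s) [:: a]; rewrite ih /=; lia.
Qed.

(** A loop consumes a list from the front, so the right fold is run as a left fold over the reversed
    list. Reversal preserves the size, hence the size hypothesis carries over. *)
Lemma polytime_foldr (f : E * (A * B) -> B) (p : nat -> nat) :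
  polytime (enc_pair eE (enc_pair eA eB)) eB f ->
  poly_bounded p ->
  (forall e b l, tsize (eB (foldr (fun a b => f (e, (a, b))) b l))
     <= p (tsize (eE e) + (tsize (eB b) + tsize (enc_seq eA l)))) ->
  polytime (enc_pair eE (enc_pair eB (enc_seq eA))) eB
    (fun x => foldr (fun a b => f (x.1, (a, b))) x.2.1 x.2.2).
Proof.
move=> hf hp hsz.
pose g (x : E * (B * A)) := f (x.1, (x.2.2, x.2.1)).
have hg : polytime (enc_pair eE (enc_pair eB eA)) eB g.
  apply: (polytime_comp2 (g := fun x => (x.2.2, x.2.1)) _ _ hf).
  - exact: polytime_fst.
  - apply: polytime_pair.
    + exact: polytime_comp (polytime_snd _ _) (polytime_snd _ _).
    + exact: polytime_comp (polytime_snd _ _) (polytime_fst _ _).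
have := polytime_foldl hg hp.
move=> /(_ _)/wrap[|h].
  move=> e b l; rewrite -[l]revK foldl_rev tsize_rev.
  exact: hsz.
apply: (eq_polytime
  (f := fun x => foldl (fun b a => g (x.1, (b, a))) x.2.1 (rev x.2.2))).
  by move=> x; rewrite foldl_rev.
refine (polytime_comp2 (f := fst) (g := fun x => (x.2.1, rev x.2.2)) _ _ h).
- exact: polytime_fst.
- apply: polytime_pair.
  + exact: polytime_comp (polytime_snd _ _) (polytime_fst _ _).
  + apply: polytime_comp polytime_rev.
    exact: polytime_comp (polytime_snd _ _) (polytime_snd _ _).
Qed.

End PolytimeLists.

Section PolytimeMap.
Variables (A B E : Type) (eA : A -> tree) (eB : B -> tree) (eE : E -> tree).

Lemma polytime_map_env (f : E * A -> B) :
  polytime (enc_pair eE eA) eB f ->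
  polytime (enc_pair eE (enc_seq eA)) (enc_seq eB)
    (fun x => [seq f (x.1, a) | a <- x.2]).
Proof.
move=> pf; have [k [hsz _]] := pf.
pose g (x : E * (A * seq B)) := f (x.1, x.2.1) :: x.2.2.
have pg : polytime (enc_pair eE (enc_pair eA (enc_seq eB))) (enc_seq eB) g.
  apply: polytime_comp2 (polytime_cons _).
  - apply: (polytime_comp2 _ _ pf); first exact: polytime_fst.
    exact: polytime_comp (polytime_snd _ _) (polytime_fst _ _).
  - exact: polytime_comp (polytime_snd _ _) (polytime_snd _ _).
have pp : poly_bounded (fun X => X * X ^ k + X) by poly_bounded.
have := polytime_foldr pg pp.
move=> /(_ _)/wrap[|h].
  move=> e b l; set te := tsize (eE e).
  have : tsize (enc_seq eB (foldr (fun a b => g (e, (a, b))) b l)) <=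
      tsize (enc_seq eA l) * (te + tsize (enc_seq eA l)) ^ k
      + tsize (enc_seq eB b).
    elim: l => [|a l ih] /=; first by rewrite leq_addl.
    rewrite mulnDl -addnA; apply: leq_add.
      apply: leq_trans (hsz _) _ => /=.
      apply: (@leq_trans ((te + (tsize (eA a) + tsize (enc_seq eA l))) ^ k)).
        by case: (k) => // k'; rewrite leq_exp2r // leq_add2l leq_addr.
      by rewrite leq_pmull // ltnW // tsize_gt1.
    apply: leq_trans ih _; rewrite leq_add2r leq_mul2l; apply/orP; right.
    by case: (k) => // k'; rewrite leq_exp2r // leq_add2l leq_addl.
  move=> /leq_trans; apply; apply: leq_add; last by lia.
  apply: leq_mul; first by lia.
  by case: (k) => // k'; rewrite leq_exp2r //; lia.
apply: (eq_polytime
  (f := fun x => foldr (fun a b => g (x.1, (a, b))) [::] x.2)).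
  by move=> [e l] /=; elim: l => //= a l ->.
refine (polytime_comp2 (f := fst) (g := fun x => ([::], x.2)) _ _ h).
- exact: polytime_fst.
- apply: polytime_pair; [exact: polytime_const|exact: polytime_snd].
Qed.

End PolytimeMap.

Lemma polytime_map (A B : Type) (eA : A -> tree) (eB : B -> tree) (f : A -> B) :
  polytime eA eB f -> polytime (enc_seq eA) (enc_seq eB) (map f).
Proof.
move=> pf; have pe : polytime (enc_pair (fun _ : unit => Leaf) eA) eB (f \o snd).
  exact: polytime_comp (polytime_snd _ _) pf.
apply: (eq_polytime (f := fun s => [seq (f \o snd) (tt, a) | a <- s])) => //.
have h := polytime_map_env pe.
refine (polytime_comp2 (f := fun=> tt) (g := fun s => s) _ _ h).
- exact: polytime_const.
- exact: polytime_cast.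
Qed.

Section PolytimeCat.
Variables (A : Type) (eA : A -> tree).

Lemma polytime_cat : polytime (enc_pair (enc_seq eA) (enc_seq eA)) (enc_seq eA)
  (fun x => x.1 ++ x.2).
Proof.
pose g (x : unit * (A * seq A)) := x.2.1 :: x.2.2.
have pg : polytime (enc_pair (fun=> Leaf) (enc_pair eA (enc_seq eA)))
    (enc_seq eA) g.
  exact: polytime_comp (polytime_snd _ _) (polytime_cons _).
have pp : poly_bounded id by poly_bounded.
have := polytime_foldr pg pp.
move=> /(_ _)/wrap[|h].
  by move=> e b l /=; elim: l => [|a l ih] /=; rewrite ?leq_addl //; lia.
apply: (eq_polytime (f := fun x => foldr (fun a b => g (tt, (a, b))) x.2 x.1)).
  by move=> [s1 s2] /=; elim: s1 => //= a s1 ->.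
refine (polytime_comp2 (f := fun=> tt) (g := fun x => (x.2, x.1)) _ _ h).
- exact: polytime_const.
- by apply: polytime_pair; [exact: polytime_snd|exact: polytime_fst].
Qed.

Lemma polytime_flatten :
  polytime (enc_seq (enc_seq eA)) (enc_seq eA) flatten.
Proof.
pose g (x : unit * (seq A * seq A)) := x.2.1 ++ x.2.2.
have pg : polytime
    (enc_pair (fun=> Leaf) (enc_pair (enc_seq eA) (enc_seq eA))) (enc_seq eA) g.
  exact: polytime_comp (polytime_snd _ _) polytime_cat.
have pp : poly_bounded id by poly_bounded.
have := polytime_foldr pg pp.
move=> /(_ _)/wrap[|h].
  move=> e b l; rewrite /g /=; elim: l => [|a l ih] /=; first by lia.
  by have := tsize_enc_cat eA a (foldr (fun a b => a ++ b) b l); lia.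
refine (polytime_comp2 (f := fun=> tt) (g := fun x => ([::], x)) _ _ h).
- exact: polytime_const.
- by apply: polytime_pair; [exact: polytime_const|exact: polytime_cast].
Qed.

End PolytimeCat.

Lemma bin_of_nat_double n : bin_of_nat n.*2 =
  if bin_of_nat n is BinNums.Npos p then BinNums.Npos (BinNums.xO p)
  else BinNums.N0.
Proof.
rewrite -{1}[n]bin_of_natK; case: (bin_of_nat n) => [//|p].
by have /= := nat_of_binK (BinNums.Npos (BinNums.xO p)); rewrite NatTrec.doubleE.
Qed.

Lemma bin_of_nat_odd n : bin_of_nat n.*2.+1 =
  if bin_of_nat n is BinNums.Npos p then BinNums.Npos (BinNums.xI p)
  else BinNums.Npos BinNums.xH.
Proof.
rewrite -{1}[n]bin_of_natK; case: (bin_of_nat n) => [//|p].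
by have /= := nat_of_binK (BinNums.Npos (BinNums.xI p)); rewrite NatTrec.doubleE.
Qed.

(** Bits are listed least significant first, so doubling prepends a bit. Only [b = false] needs a
    test: zero is the empty list and has to stay empty. *)
Lemma polytime_double (b : bool) :
  polytime enc_nat enc_nat (fun n => b + n.*2).
Proof.
case: b.
- apply: (polytime_expr (e := fun d => Cons (Cons Nil Nil) (Var d)) (n := 7)).
  + move=> d s n /= ->; rewrite /enc_nat bin_of_nat_odd.
    by case: (bin_of_nat n).
  + by [].
  + by move=> n; rewrite /enc_nat bin_of_nat_odd; case: (bin_of_nat n) => //= p; lia.
- apply: (polytime_intro (p := fun X => X + 4) (q := fun=> 10)).
  + by poly_bounded.
  + by poly_bounded.
  + move=> n; rewrite add0n /enc_nat bin_of_nat_double; case: (bin_of_nat n) => //= q; lia.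
  move=> d; exists (If (Var d) (Assign d (Cons Nil (Var d))) Skip) => s n sn.
  rewrite add0n.
  set P := fun s' => _.
  apply: (run_weaken (P := P) (T := (1 + 4).+1)) => //; apply: run_if => /=.
  rewrite /enc_nat in sn.
  rewrite sn /P /enc_nat bin_of_nat_double; case: (bin_of_nat n) sn => [|q] sn /=.
  + by exists 1, s; split; [exact: ExecSkip| |].
  + have -> : is_true_tree (enc_pos q) by case: (q).
    apply: run_assign; rewrite /update eqxx /= sn; split=> // y yd.
    by rewrite ltn_eqF.
Qed.

(** * The reduction *)

Definition lit := (nat * bool)%type.

Definition enc_lit : lit -> tree := enc_pair enc_nat enc_bool.
Definition enc_clause : seq lit -> tree := enc_seq enc_lit.
Definition enc_clauses : seq (seq lit) -> tree := enc_seq enc_clause.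
Definition enc_blocks : seq (seq (seq lit)) -> tree := enc_seq enc_clauses.

(** Variable [j] of the 3CNF owns the 16 variables [slot s j] of the abduction
    problem: the hypotheses [slot 0 j] and [slot 1 j] assert that it is true and
    false, [slot 3 j] is an unconstrained hypothesis, and the [slot s j] with
    [8 <= s] address the clauses.  The only manifestation is [2 = slot 2 0]. *)
Definition slot (s j : nat) : nat := s + 16 * j.

Definition manifestation : nat := 2.

Definition hyp_of (l : lit) : nat := if l.2 then slot 0 l.1 else slot 1 l.1.

Definition slots (ss l : seq nat) : seq nat :=
  flatten [seq [seq slot s j | s <- ss] | j <- l].

Definition conflicts (l : seq nat) : seq (seq lit) :=
  [seq [:: (slot 0 j, false); (slot 1 j, false)] | j <- l].

(** Entails the manifestation as soon as a literal of the clause is asserted. *)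
Definition block_of (C : seq lit) : seq (seq lit) :=
  [seq [:: (hyp_of l, false); (manifestation, true)] | l <- C].

(** A true [b] satisfies all clauses coming from [A], a false one all those coming from [B]: the bit
    [b] of an address decides which block stays in force. *)
Definition merge_blocks (b : nat) (A B : seq (seq lit)) : seq (seq lit) :=
  [seq (b, true) :: C | C <- A] ++ [seq (b, false) :: C | C <- B].

Arguments merge_blocks : simpl never.

(** [st.1] is empty or holds the one block that waits for a partner; [st.2] collects the merged
    blocks. *)
Definition round_step (b : nat) (A : seq (seq lit))
    (st : seq (seq (seq lit)) * seq (seq (seq lit))) :=
  if nilp st.1 then ([:: A], st.2)
  else ([::], merge_blocks b A (head [::] st.1) :: st.2).

(** A round of a knockout tournament: blocks are merged in pairs. *)
Definition round (Bs : seq (seq (seq lit))) (b : nat) :=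
  let st := foldr (round_step b) ([::], [::]) Bs in st.1 ++ st.2.

Definition tournament (bs : seq nat) (Bs : seq (seq (seq lit))) :=
  foldl round Bs bs.

(** The first block makes the list nonempty and entails the manifestation. *)
Definition blocks (F : seq (seq lit)) : seq (seq (seq lit)) :=
  [:: [:: (manifestation, true)]] :: [seq block_of C | C <- F].

Definition theory (l : seq nat) (F : seq (seq lit)) : seq (seq lit) :=
  conflicts l ++ flatten (tournament (slots (iota 8 8) l) (blocks F)).

(** A 3CNF without variables receives a dummy one, so that the manifestation and the unconstrained
    hypothesis exist. *)
Definition pad (l : seq nat) : seq nat := if nilp l then [:: 0] else l.

Definition enc_nats : seq nat -> tree := enc_seq enc_nat.

Definition enc_raw_pap :=
  enc_pair enc_nats (enc_pair enc_nats (enc_pair enc_nats enc_clauses)).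

Definition reduction (x : seq nat * seq (seq lit)) :=
  (slots (iota 0 16) (pad x.1),
   (slots [:: 0; 1; 3] (pad x.1),
    ([:: manifestation], theory (pad x.1) x.2))).

(** * The reduction runs in polynomial time *)

Lemma polytime_slot s : s < 16 -> polytime enc_nat enc_nat (slot s).
Proof.
move=> s16.
pose d (b : bool) n := b + n.*2.
(* As 16 is a power of two, the four bits of [s] are simply prepended to those of [j]; no addition
   has to be programmed. *)
apply: (eq_polytime (f := d (odd s) \o (d (odd s./2) \o
    (d (odd s./2./2) \o d (odd s./2./2./2))))).
  move=> j; rewrite /d /slot /=.
  have := odd_double_half s; have := odd_double_half s./2.
  have := odd_double_half s./2./2; have := odd_double_half s./2./2./2.
  by lia.
have hd b := polytime_double b.
exact: polytime_comp (polytime_comp (polytime_comp (hd _) (hd _)) (hd _)) (hd _).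
Qed.

Lemma polytime_slots ss :
  all (fun s => s < 16) ss -> polytime enc_nats enc_nats (slots ss).
Proof.
move=> ss16; apply: polytime_comp (polytime_flatten _).
apply: polytime_map; elim: ss ss16 => [|s ss ih] /= => [_|/andP[s16 /ih h]].
  exact: polytime_const.
exact: polytime_comp2 (polytime_slot s16) h (polytime_cons _).
Qed.

Lemma polytime_hyp_of : polytime enc_lit enc_nat hyp_of.
Proof.
apply: polytime_if; first exact: polytime_snd.
- exact: polytime_comp (polytime_fst _ _) (polytime_slot _).
- exact: polytime_comp (polytime_fst _ _) (polytime_slot _).
Qed.

Lemma polytime_nilp (A : Type) (eA : A -> tree) :
  polytime (enc_seq eA) enc_bool (@nilp A).
Proof.
pose p (s : seq A) := ~~ nilp s.
have hp : polytime (enc_seq eA) enc_bool p.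
  by apply: polytime_test => - [].
apply: (eq_polytime (f := fun s => if p s then false else true)).
  by move=> s; rewrite /p; case: nilp.
by apply: polytime_if hp _ _; exact: polytime_const.
Qed.

Lemma polytime_pad : polytime enc_nats enc_nats pad.
Proof.
apply: polytime_if; first exact: polytime_nilp.
- exact: polytime_const.
- exact: polytime_cast.
Qed.

Lemma polytime_conflicts : polytime enc_nats enc_clauses conflicts.
Proof.
apply: polytime_map.
have hs s : s < 16 ->
    polytime enc_nat enc_lit (fun j => (slot s j, false)).
  by move=> /polytime_slot h; apply: polytime_pair h (polytime_const _ _ _).
refine (polytime_comp2 (hs 0 isT) _ (polytime_cons _)).
refine (polytime_comp2 (hs 1 isT) _ (polytime_cons _)).
exact: polytime_const.
Qed.

Lemma polytime_block_of : polytime enc_clause enc_clauses block_of.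
Proof.
apply: polytime_map.
have h : polytime enc_lit enc_lit (fun l => (hyp_of l, false)).
  by apply: polytime_pair polytime_hyp_of (polytime_const _ _ _).
by refine (polytime_comp2 h (polytime_const _ _ [:: (manifestation, true)])
  (polytime_cons _)).
Qed.

Lemma polytime_blocks : polytime enc_clauses enc_blocks blocks.
Proof.
refine (polytime_comp2 (polytime_const _ _ [:: [:: (manifestation, true)]])
  _ (polytime_cons _)).
exact: polytime_map polytime_block_of.
Qed.

Lemma polytime_merge_blocks :
  polytime (enc_pair enc_nat (enc_pair enc_clauses enc_clauses)) enc_clauses
    (fun x => merge_blocks x.1 x.2.1 x.2.2).
Proof.
have h v : polytime (enc_pair enc_nat enc_clauses) enc_clauses
    (fun x => [seq (x.1, v) :: C | C <- x.2]).
  apply: (polytime_map_env (f := fun x => (x.1, v) :: x.2)).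
  refine (polytime_comp2 _ (polytime_snd _ _) (polytime_cons _)).
  exact: polytime_pair (polytime_fst _ _) (polytime_const _ _ _).
refine (polytime_comp2 _ _ (polytime_cat _)).
- refine (polytime_comp2 (polytime_fst _ _) _ (h true)).
  exact: polytime_comp (polytime_snd _ _) (polytime_fst _ _).
- refine (polytime_comp2 (polytime_fst _ _) _ (h false)).
  exact: polytime_comp (polytime_snd _ _) (polytime_snd _ _).
Qed.

Lemma polytime_round_step :
  polytime (enc_pair enc_nat (enc_pair enc_clauses
      (enc_pair enc_blocks enc_blocks)))
    (enc_pair enc_blocks enc_blocks)
    (fun x => round_step x.1 x.2.1 x.2.2).
Proof.
have pA : polytime (enc_pair enc_nat (enc_pair enc_clauses
      (enc_pair enc_blocks enc_blocks))) enc_clauses (fun x => x.2.1).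
  exact: polytime_comp (polytime_snd _ _) (polytime_fst _ _).
have pst : polytime (enc_pair enc_nat (enc_pair enc_clauses
      (enc_pair enc_blocks enc_blocks))) (enc_pair enc_blocks enc_blocks)
      (fun x => x.2.2).
  exact: polytime_comp (polytime_snd _ _) (polytime_snd _ _).
have pst1 := polytime_comp pst (polytime_fst _ _).
have pst2 := polytime_comp pst (polytime_snd _ _).
have phead : polytime enc_blocks enc_clauses (head [::]).
  exact: polytime_head.
refine (polytime_if (f := fun x => ([:: x.2.1], x.2.2.2))
  (g := fun x => ([::], merge_blocks x.1 x.2.1 (head [::] x.2.2.1) :: x.2.2.2))
  (polytime_comp pst1 (polytime_nilp _)) _ _).
- refine (polytime_pair _ pst2).
  by refine (polytime_comp2 pA (polytime_const _ _ [::]) (polytime_cons _)).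
- refine (polytime_pair (polytime_const _ _ [::]) _).
  refine (polytime_comp2 _ pst2 (polytime_cons _)).
  refine (polytime_comp2 (g := fun x => (x.2.1, head [::] x.2.2.1))
    (polytime_fst _ _) _ polytime_merge_blocks).
  exact: polytime_pair pA (polytime_comp pst1 phead).
Qed.

Lemma tsize_cons_lit (l : lit) (A : seq (seq lit)) :
  tsize (enc_clauses [seq l :: C | C <- A])
  = tsize (enc_clauses A) + size A * tsize (enc_lit l).
Proof.
have tsize_cons C A' : tsize (enc_clauses (C :: A'))
  = tsize (enc_clause C) + tsize (enc_clauses A') by [].
elim: A => [|C A ih] //; rewrite map_cons !tsize_cons ih.
rewrite [size (C :: A)]/= mulSn.
have -> : tsize (enc_clause (l :: C)) = tsize (enc_lit l) + tsize (enc_clause C).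
  by [].
by lia.
Qed.

Lemma tsize_merge_blocks b (A B : seq (seq lit)) :
  tsize (enc_clauses (merge_blocks b A B)) + 2
  <= tsize (enc_clauses A) + tsize (enc_clauses B)
     + (size A + size B) * (tsize (enc_nat b) + 4).
Proof.
rewrite tsize_enc_cat -!/enc_clauses !tsize_cons_lit /=.
by rewrite mulnDl !mulnDr /=; lia.
Qed.

(** Induction that carries along the invariant that at most one block is pending, which leaves just
    the two transitions below. *)
Lemma foldr_round_step_ind (P : seq (seq (seq lit)) ->
    seq (seq (seq lit)) * seq (seq (seq lit)) -> Prop) b :
  P [::] ([::], [::]) ->
  (forall A Bs out, P Bs ([::], out) -> P (A :: Bs) ([:: A], out)) ->
  (forall A Bs B out, P Bs ([:: B], out) ->
    P (A :: Bs) ([::], merge_blocks b A B :: out)) ->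
  forall Bs, P Bs (foldr (round_step b) ([::], [::]) Bs).
Proof.
move=> h0 h1 h2 Bs.
suff [] : P Bs (foldr (round_step b) ([::], [::]) Bs) /\
   size (foldr (round_step b) ([::], [::]) Bs).1 <= 1 by [].
elim: Bs => //= A Bs []; case: foldr => [[|B [|//]] out] /= ih _.
- by split=> //; exact: h1.
- by split=> //; exact: h2.
Qed.

(** A round lengthens clauses but does not change their number. The growth in each round is thus
    charged to the initial number of clauses, and repeated rounds stay polynomial. *)
Lemma size_flatten_round b Bs : size (flatten (round Bs b)) = size (flatten Bs).
Proof.
rewrite /round; apply: (foldr_round_step_ind (P := fun Bs st =>
   size (flatten (st.1 ++ st.2)) = size (flatten Bs))) => //=.
- by move=> A Bs' out; rewrite !size_cat => ->.
- by move=> A Bs' B out; rewrite !size_cat !size_map -addnA => ->.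
Qed.

(** The potential charges the cost of the merge to the pending block. *)
Definition round_potential (q : nat)
    (st : seq (seq (seq lit)) * seq (seq (seq lit))) : nat :=
  tsize (enc_pair enc_blocks enc_blocks st) + size (flatten st.1) * q.

(** The starting state is arbitrary because [polytime_foldr] wants its size bound for every initial
    accumulator. *)
Lemma round_potential_foldr b st0 Bs :
  round_potential (tsize (enc_nat b) + 4) (foldr (round_step b) st0 Bs) + 2
  <= tsize (enc_blocks Bs) + size (flatten Bs) * (tsize (enc_nat b) + 4)
     + round_potential (tsize (enc_nat b) + 4) st0.
Proof.
elim: Bs => [|A Bs]; first by rewrite /=; lia.
rewrite [foldr _ _ (_ :: _)]/=; case: foldr => [[|B pend] out] ih.
- rewrite /round_step /round_potential /= !size_cat /=.
  by move: ih; rewrite /round_potential /= -/enc_blocks mulnDl; lia.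
- have := tsize_merge_blocks b A B.
  move: ih; rewrite /round_step /round_potential /= !size_cat.
  rewrite -!/enc_blocks !mulnDl.
  have := tsize_gt1 (enc_blocks pend); lia.
Qed.

Lemma tsize_round b Bs :
  tsize (enc_blocks (round Bs b))
  <= tsize (enc_blocks Bs) + size (flatten Bs) * (tsize (enc_nat b) + 4).
Proof.
have := round_potential_foldr b ([::], [::]) Bs.
rewrite /round /round_potential /=; set st := foldr _ _ _.
by have := tsize_enc_cat enc_clauses st.1 st.2; rewrite -/enc_blocks; lia.
Qed.

Lemma size_flatten_le_tsize (Bs : seq (seq (seq lit))) :
  size (flatten Bs) <= tsize (enc_blocks Bs).
Proof.
elim: Bs => //= A Bs ih; rewrite size_cat leq_add //.
by have := size_le_tsize enc_clause A; rewrite -/enc_clauses; lia.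
Qed.

Lemma polytime_round :
  polytime (enc_pair enc_blocks enc_nat) enc_blocks (fun x => round x.1 x.2).
Proof.
pose f (x : nat * (seq (seq lit) * _)) := round_step x.1 x.2.1 x.2.2.
have pf : polytime (enc_pair enc_nat (enc_pair enc_clauses
    (enc_pair enc_blocks enc_blocks))) (enc_pair enc_blocks enc_blocks) f.
  exact: polytime_round_step.
have pp : poly_bounded (fun X => X + X * (X + 4) + (X + X * (X + 4))).
  by poly_bounded.
have := polytime_foldr pf pp.
move=> /(_ _)/wrap[b st0 Bs|h].
  have := round_potential_foldr b st0 Bs; rewrite /round_potential /=.
  rewrite -/(enc_blocks Bs); set st := foldr _ _ _.
  set Y := tsize (enc_nat b) + (_ + tsize (enc_blocks Bs)).
  have := tsize_gt1 (enc_nat b).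
  have := size_flatten_le_tsize Bs; have := size_flatten_le_tsize st0.1.
  have := tsize_gt1 (enc_blocks Bs); have := tsize_gt1 (enc_blocks st0.2).
  move=> *.
  have : size (flatten Bs) * (tsize (enc_nat b) + 4) <= Y * (Y + 4).
    by apply: leq_mul; rewrite /Y; lia.
  have : size (flatten st0.1) * (tsize (enc_nat b) + 4) <= Y * (Y + 4).
    by apply: leq_mul; rewrite /Y; lia.
  by rewrite /Y; lia.
refine (polytime_comp (f := fun x => foldr (round_step x.2) ([::], [::]) x.1)
  _ (polytime_cat _)).
refine (polytime_comp2 (f := snd) (g := fun x => (([::], [::]), x.1)) _ _ h).
- exact: polytime_snd.
- exact: polytime_pair (polytime_const _ _ _) (polytime_fst _ _).
Qed.

(** A round charges [tsize (enc_nat b) + 4] to each clause; since sizes are at least 2, this is at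
    most [3 * tsize (enc_nat b)]. *)
Lemma tsize_tournament bs Bs :
  tsize (enc_blocks (tournament bs Bs))
  <= tsize (enc_blocks Bs) + size (flatten Bs) * (3 * tsize (enc_nats bs)).
Proof.
elim: bs Bs => [|b bs ih] Bs /=; first by rewrite leq_addr.
apply: leq_trans (ih _) _; rewrite size_flatten_round -/enc_nats.
apply: leq_trans (leq_add (tsize_round _ _) (leqnn _)) _.
rewrite -addnA leq_add2l -mulnDr leq_mul2l; apply/orP; right.
by have := tsize_gt1 (enc_nat b); lia.
Qed.

Lemma polytime_tournament :
  polytime (enc_pair enc_nats enc_blocks) enc_blocks
    (fun x => tournament x.1 x.2).
Proof.
pose f (x : unit * (seq (seq (seq lit)) * nat)) := round x.2.1 x.2.2.
have pf : polytime (enc_pair (fun=> Leaf) (enc_pair enc_blocks enc_nat))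
    enc_blocks f.
  exact: polytime_comp (polytime_snd _ _) polytime_round.
have pp : poly_bounded (fun X => X + X * (3 * X)) by poly_bounded.
have := polytime_foldl pf pp.
move=> /(_ _)/wrap[u Bs bs|h].
  apply: leq_trans (tsize_tournament bs Bs) _.
  apply: leq_add; first by lia.
  have := size_flatten_le_tsize Bs => ?; apply: leq_mul; first by lia.
  by rewrite -/enc_nats; lia.
refine (polytime_comp2 (f := fun=> tt) (g := fun x => (x.2, x.1)) _ _ h).
- exact: polytime_const.
- exact: polytime_pair (polytime_snd _ _) (polytime_fst _ _).
Qed.

Lemma polytime_theory :
  polytime (enc_pair enc_nats enc_clauses) enc_clauses
    (fun x => theory x.1 x.2).
Proof.
refine (polytime_comp2 _ _ (polytime_cat _)).
  exact: polytime_comp (polytime_fst _ _) polytime_conflicts.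
refine (polytime_comp _ (polytime_flatten _)).
refine (polytime_comp2 _ _ polytime_tournament).
- exact: polytime_comp (polytime_fst _ _) (@polytime_slots (iota 8 8) isT).
- exact: polytime_comp (polytime_snd _ _) polytime_blocks.
Qed.

Lemma polytime_reduction :
  polytime (enc_pair enc_nats enc_clauses) enc_raw_pap reduction.
Proof.
have pl : polytime (enc_pair enc_nats enc_clauses) enc_nats (fun x => pad x.1).
  exact: polytime_comp (polytime_fst _ _) polytime_pad.
refine (polytime_pair (polytime_comp pl (@polytime_slots (iota 0 16) isT)) _).
refine (polytime_pair (polytime_comp pl (@polytime_slots [:: 0; 1; 3] isT)) _).
refine (polytime_pair (polytime_const _ _ _) _).
exact: polytime_comp2 pl (polytime_snd _ _) polytime_theory.
Qed.

(** * Correctness *)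

Definition sat_lit (h : nat -> bool) (l : lit) : bool := h l.1 == l.2.

Definition sat_clauses (h : nat -> bool) (T : seq (seq lit)) : bool :=
  all (has (sat_lit h)) T.

Lemma sat_clauses_cat h T1 T2 :
  sat_clauses h (T1 ++ T2) = sat_clauses h T1 && sat_clauses h T2.
Proof. exact: all_cat. Qed.

(** The variables [v] with [8 <= v %% 16] are the addressing variables. *)
Definition escapes (h : nat -> bool) (A : seq (seq lit)) : Prop :=
  exists g : nat -> bool,
    (forall v, v %% 16 < 8 -> g v = h v) /\ sat_clauses g A.

(** The last condition bounds the treewidth: a clause contains addressing
    variables from [us] only, and [slot 0 j] or [slot 1 j] for one [j] only. *)
Definition block_ok (N : nat) (us : seq nat) (A : seq (seq lit)) : Prop :=
  [/\ uniq A, all uniq A,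
      forall C, C \in A -> (manifestation, true) \in C
    & forall C, C \in A -> exists2 j, j < N & forall v, v \in unzip1 C ->
        [\/ v \in us, v = manifestation, v = slot 0 j | v = slot 1 j]].

Lemma block_ok_fresh N us A C b :
  block_ok N us A -> C \in A -> 8 <= b %% 16 -> b \notin us ->
  b \notin unzip1 C.
Proof.
move=> [_ _ _ hA] /hA[j _ hC] b8 bus; apply/negP => /hC[].
- by rewrite (negbTE bus).
- by move=> eb; move: b8; rewrite eb.
- by move=> eb; move: b8; rewrite eb /slot; lia.
- by move=> eb; move: b8; rewrite eb /slot; lia.
Qed.

Lemma block_ok_weaken N us b A : block_ok N us A -> block_ok N (b :: us) A.
Proof.
move=> [uA aA mA sA]; split=> // C /sA[j jN hC]; exists j => // v /hC[].
- by move=> vus; apply: Or41; rewrite inE vus orbT.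
- exact: Or42.
- exact: Or43.
- exact: Or44.
Qed.

Lemma block_ok_merge N us b A B :
  8 <= b %% 16 -> b \notin us ->
  block_ok N us A -> block_ok N us B -> block_ok N (b :: us) (merge_blocks b A B).
Proof.
move=> b8 bus okA okB; have [uA aA mA sA] := okA; have [uB aB mB sB] := okB.
have memP C : C \in merge_blocks b A B ->
    exists v C', C = (b, v) :: C' /\ (C' \in A \/ C' \in B).
  rewrite mem_cat => /orP[] /mapP[C' hC' ->].
  - by exists true, C'; split=> //; left.
  - by exists false, C'; split=> //; right.
have fresh C : C \in A \/ C \in B -> b \notin unzip1 C.
  by case=> hC; [apply: block_ok_fresh okA _ _ _|apply: block_ok_fresh okB _ _ _].
split.
- rewrite cat_uniq !map_inj_uniq ?uA ?uB //=; try by move=> ? ? [].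
  rewrite andbT; apply/hasPn => _ /mapP[C _ ->]; apply/mapP.
  by move=> [C' _ []].
- apply/allP => _ /memP[v [C [-> hC]]] /=; apply/andP; split.
    apply: contra (fresh _ hC) => hb; apply/mapP; by exists (b, v).
  by case: hC; apply/allP.
- move=> _ /memP[v [C [-> hC]]]; rewrite inE; apply/orP; right.
  by case: hC => [/mA|/mB].
- move=> _ /memP[v [C [-> hC]]].
  have [j jN hj] : exists2 j, j < N & forall v, v \in unzip1 C ->
      [\/ v \in us, v = manifestation, v = slot 0 j | v = slot 1 j].
    by case: hC => [/sA|/sB].
  exists j => // w; rewrite inE => /orP[/eqP ->|/hj[]].
  + by apply: Or41; rewrite inE eqxx.
  + by move=> wus; apply: Or41; rewrite inE wus orbT.
  + exact: Or42.
  + exact: Or43.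
  + exact: Or44.
Qed.

(** The bit [b] occurs in neither block, so an address that escapes one of them may be overwritten
    at [b] to select that block. *)
Lemma escapes_merge N us h b A B :
  8 <= b %% 16 -> b \notin us ->
  block_ok N us A -> block_ok N us B ->
  escapes h (merge_blocks b A B) <-> escapes h A \/ escapes h B.
Proof.
move=> b8 bus okA okB.
have sat_mergeE g : sat_clauses g (merge_blocks b A B) =
    if g b then sat_clauses g B else sat_clauses g A.
  rewrite sat_clauses_cat /sat_clauses !all_map /preim /= /sat_lit /=.
  case: (g b) => /=; first by rewrite all_predT.
  by rewrite all_predT andbT.
split.
- move=> [g [gh]]; rewrite sat_mergeE; case: ifP => _ hg.
  + by right; exists g.
  + by left; exists g.
have set_bit D v g : block_ok N us D -> sat_clauses g D ->
    sat_clauses (fun w => if w == b then v else g w) D.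
  move=> okD /allP hD; apply/allP => C CD; have /hasP[l lC hl] := hD _ CD.
  apply/hasP; exists l => //; rewrite /sat_lit.
  have := block_ok_fresh okD CD b8 bus; case: (l.1 =P b) => [<- /negP[]|//].
  exact: map_f.
by move=> [] [g [gh hg]]; [exists (fun w => if w == b then false else g w)
   | exists (fun w => if w == b then true else g w)];
   (split; last by rewrite sat_mergeE eqxx; exact: set_bit hg) => w w8;
   rewrite -gh //; case: eqP w8 => // ->; rewrite ltnNge b8.
Qed.

Lemma round_correct N us h b Bs :
  8 <= b %% 16 -> b \notin us ->
  (forall A, A \in Bs -> block_ok N us A) ->
  (forall A, A \in round Bs b -> block_ok N (b :: us) A) /\
  ((exists2 A, A \in round Bs b & escapes h A) <->
   (exists2 A, A \in Bs & escapes h A)).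
Proof.
move=> b8 bus; rewrite /round.
have exists_cons D Ds : (exists2 A, A \in D :: Ds & escapes h A) <->
    escapes h D \/ exists2 A, A \in Ds & escapes h A.
  split=> [[A]|[hD|[A ADs hA]]].
  - by rewrite inE => /orP[/eqP -> | ADs] hA; [left|right; exists A].
  - by exists D => //; rewrite mem_head.
  - by exists A => //; rewrite inE ADs orbT.
(* The pending block has not met [b] yet and is kept over [us]: this is the freshness required when
   it is merged. *)
suff : (forall A, A \in Bs -> block_ok N us A) ->
    [/\ forall A, A \in (foldr (round_step b) ([::], [::]) Bs).1 ->
          block_ok N us A,
        forall A, A \in (foldr (round_step b) ([::], [::]) Bs).2 ->
          block_ok N (b :: us) A
      & (exists2 A, A \in (foldr (round_step b) ([::], [::]) Bs).1 ++
          (foldr (round_step b) ([::], [::]) Bs).2 & escapes h A) <->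
        (exists2 A, A \in Bs & escapes h A)].
  move=> + ok => /(_ ok)[ok1 ok2 hex]; split=> // A.
  by rewrite mem_cat => /orP[/ok1/block_ok_weaken|/ok2]; exact.
apply: (foldr_round_step_ind (P := fun Bs st =>
  (forall A, A \in Bs -> block_ok N us A) ->
  [/\ forall A, A \in st.1 -> block_ok N us A,
      forall A, A \in st.2 -> block_ok N (b :: us) A
    & (exists2 A, A \in st.1 ++ st.2 & escapes h A) <->
      (exists2 A, A \in Bs & escapes h A)])).
- by [].
- move=> A Bs' out ih ok; have [|_ ok2 hex] := ih.
    by move=> B hB; apply: ok; rewrite inE hB orbT.
  split=> //=.
  + by move=> B; rewrite inE => /eqP ->; apply: ok; rewrite mem_head.
  + by rewrite !exists_cons -hex.
- move=> A Bs' B out ih ok; have [|ok1 ok2 hex] := ih.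
    by move=> D hD; apply: ok; rewrite inE hD orbT.
  have okA : block_ok N us A by apply: ok; rewrite mem_head.
  have okB : block_ok N us B by apply: ok1; rewrite mem_head.
  split=> //=.
  + move=> D; rewrite inE => /orP[/eqP ->|/ok2//].
    exact: block_ok_merge.
  + rewrite !exists_cons -hex /= exists_cons (escapes_merge h b8 bus okA okB).
    by split=> [[[|]|]|[|[|]]]; tauto.
Qed.

Lemma tournament_correct N us h bs Bs :
  uniq bs -> (forall b, b \in bs -> 8 <= b %% 16) ->
  (forall b, b \in bs -> b \notin us) ->
  (forall A, A \in Bs -> block_ok N us A) ->
  (forall A, A \in tournament bs Bs -> block_ok N (catrev bs us) A) /\
  ((exists2 A, A \in tournament bs Bs & escapes h A) <->
   (exists2 A, A \in Bs & escapes h A)).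
Proof.
elim: bs us Bs => [//|b bs ih] us Bs /= /andP[bbs ubs] hbs hus ok.
have b8 : 8 <= b %% 16 by apply: hbs; rewrite mem_head.
have bus : b \notin us by apply: hus; rewrite mem_head.
have [ok1 ex1] := round_correct h b8 bus ok.
have [] := ih (b :: us) (round Bs b) ubs _ _ ok1.
- by move=> c cbs; apply: hbs; rewrite inE cbs orbT.
- move=> c cbs; rewrite inE negb_or hus ?inE ?cbs ?orbT // andbT.
  by apply: contraNneq bbs => <-.
by move=> ok2 ex2; split=> //; rewrite ex2 ex1.
Qed.

Lemma size_round b Bs : size (round Bs b) = uphalf (size Bs).
Proof.
rewrite /round size_cat; suff [-> ->] :
    size (foldr (round_step b) ([::], [::]) Bs).1 = odd (size Bs) /\
    size (foldr (round_step b) ([::], [::]) Bs).2 = (size Bs)./2.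
  by rewrite uphalf_half.
apply: (foldr_round_step_ind (P := fun Bs st =>
  size st.1 = odd (size Bs) /\ size st.2 = (size Bs)./2)) => //=.
- by move=> A Bs' out [h1 ->]; rewrite uphalf_half -h1; split; lia.
- by move=> A Bs' B out [h1 ->]; rewrite uphalf_half -h1; split; lia.
Qed.

Lemma size_tournament bs Bs :
  0 < size Bs <= 2 ^ size bs -> size (tournament bs Bs) = 1.
Proof.
elim: bs Bs => [|b bs ih] Bs /= h; first by apply/eqP; rewrite eqn_leq andbC.
apply: ih; rewrite size_round; move: h; rewrite expnS; lia.
Qed.

(** A round leaves a single block unchanged, so the bits after the first [r] never enter a clause.
    Linearly many bits are offered, but only logarithmically many count for the treewidth. *)
Lemma tournament_take r bs Bs :
  0 < size Bs <= 2 ^ r -> r <= size bs ->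
  tournament bs Bs = tournament (take r bs) Bs.
Proof.
move=> h hr; rewrite -[in LHS](cat_take_drop r bs) /tournament foldl_cat.
rewrite -!/(tournament _ _).
have : size (tournament (take r bs) Bs) = 1.
  by apply: size_tournament; rewrite size_takel.
case: tournament => [//|A [|//]] _.
by elim: (drop r bs).
Qed.

Lemma block_of_ok N C :
  uniq C -> (forall l, l \in C -> l.1 < N) -> block_ok N [::] (block_of C).
Proof.
move=> uC hC; split.
- rewrite map_inj_in_uniq // => -[j s] [j' s'] _ _ [].
  by rewrite /hyp_of /slot; case: s s' => [] [] /= ?; congr (_, _); lia.
- by apply/allP => _ /mapP[[j s] _ ->]; rewrite /= inE xpair_eqE andbF.
- by move=> _ /mapP[l _ ->]; rewrite !inE eqxx orbT.
- move=> _ /mapP[l /hC lN ->]; exists l.1 => // v; rewrite !inE.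
  move=> /orP[/eqP ->|/eqP ->]; last exact: Or42.
  by rewrite /= /hyp_of; case: l.2; [apply: Or43|apply: Or44].
Qed.

Lemma blocks_ok N F :
  0 < N -> all uniq F -> (forall C l, C \in F -> l \in C -> l.1 < N) ->
  forall A, A \in blocks F -> block_ok N [::] A.
Proof.
move=> N0 /allP uF hF A; rewrite inE => /orP[/eqP ->|/mapP[C CF ->]].
- split=> //.
  + by move=> C; rewrite inE => /eqP ->; rewrite mem_head.
  + move=> C; rewrite inE => /eqP ->; exists 0 => // v.
    by rewrite inE => /eqP ->; exact: Or42.
- by apply: block_of_ok; [exact: uF|move=> l; exact: hF].
Qed.

(** When the manifestation is false, the first block is violated, and the clauses of [block_of C]
    hold exactly if no literal of [C] is asserted. Neither kind of block contains addressing
    variables, so their values are irrelevant here. *)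
Lemma escapes_blocks h F : h manifestation = false ->
  (exists2 A, A \in blocks F & escapes h A) <->
  (exists2 C, C \in F & forall l, l \in C -> h (hyp_of l) = false).
Proof.
move=> hm; split=> [[A]|[C CF hC]].
- rewrite inE => /orP[/eqP ->|/mapP[C CF ->]] [g [gh]].
    by rewrite /sat_clauses /sat_lit /= gh // hm.
  move=> /allP hg; exists C => // l lC.
  have := hg _ (map_f _ lC); rewrite /= /sat_lit /= !gh //.
  + by rewrite hm => /or3P[/eqP| |].
  + by rewrite /hyp_of /slot; case: l.2; lia.
- exists (block_of C); first by rewrite inE map_f ?orbT.
  exists h; split=> //; apply/allP => _ /mapP[l lC ->].
  by rewrite /= /sat_lit /= hC.
Qed.

(** * Variable sets and formulas over natural numbers and over ordinals *)

Lemma mem_slots (ss l : seq nat) v :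
  all (fun s => s < 16) ss ->
  (v \in slots ss l) = (v %% 16 \in ss) && (v %/ 16 \in l).
Proof.
move=> /allP ss16; apply/flattenP/andP => [[_ /mapP[j jl ->] /mapP[s sss ->]]|].
- have s16 := ss16 _ sss; rewrite /slot.
  have -> : (s + 16 * j) %% 16 = s by lia.
  by have -> : (s + 16 * j) %/ 16 = j by lia.
- move=> [vs vl]; exists [seq slot s (v %/ 16) | s <- ss].
    by apply/mapP; exists (v %/ 16).
  by apply/mapP; exists (v %% 16) => //; rewrite /slot; lia.
Qed.

(** The hypothesis says that [ss] is increasing. The program then lists the slots in the order of
    [enum], as literal equality of the encodings demands. *)
Lemma slots_iota (ss : seq nat) N : [seq s <- iota 0 16 | s \in ss] = ss ->
  slots ss (iota 0 N) = [seq v <- iota 0 (16 * N) | v %% 16 \in ss].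
Proof.
move=> hss; elim: N => [//|N ih].
rewrite -addn1 iotaD /slots map_cat flatten_cat -/(slots _ _) ih add0n /= cats0.
rewrite mulnDr iotaD filter_cat add0n; congr (_ ++ _).
rewrite muln1 -[X in iota X _]addn0 iotaDl filter_map.
rewrite (@eq_in_filter _ (preim _ _) (mem ss)); last first.
  move=> s; rewrite mem_iota /= => s16.
  by have -> : (16 * N + s) %% 16 = s by lia.
have -> : [seq s <- iota 0 16 | mem ss s] = ss by exact: hss.
apply: eq_map => s; exact: addnC.
Qed.

Definition raw (n : nat) (F : cnf n) : seq (seq lit) :=
  [seq [seq (val l.1, l.2) | l <- C] | C <- F].

Lemma enc_cnf_raw n (F : cnf n) : enc_cnf F = enc_clauses (raw F).
Proof.
by elim: F => //= C F ->; congr Node; elim: C => //= l C ->.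
Qed.

Lemma satisfies_raw n (a : {ffun 'I_n.+1 -> bool}) (F : cnf n.+1) :
  satisfies a F = sat_clauses (fun v => a (inord v)) (raw F).
Proof.
rewrite /satisfies /sat_clauses all_map; apply: eq_all => C /=.
by rewrite has_map; apply: eq_has => l; rewrite /= /sat_lit /= inord_val.
Qed.

Lemma satisfies_raw_ffun n (g : nat -> bool) (F : cnf n) :
  satisfies [ffun i : 'I_n => g i] F = sat_clauses g (raw F).
Proof.
rewrite /satisfies /sat_clauses all_map; apply: eq_all => C /=.
by rewrite has_map; apply: eq_has => l; rewrite /= /sat_lit /= ffunE.
Qed.

Definition unraw (n : nat) (T : seq (seq lit)) : cnf n.+1 :=
  [seq [seq (inord l.1, l.2) | l <- C] | C <- T].

Lemma unrawK n (T : seq (seq lit)) :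
  (forall C v, C \in T -> v \in unzip1 C -> v < n.+1) -> raw (unraw n T) = T.
Proof.
move=> hT; rewrite /raw /unraw -map_comp -[RHS]map_id; apply/eq_in_map => C CT.
rewrite /= -map_comp -[RHS]map_id; apply/eq_in_map => -[v s] lC /=.
by rewrite inordK // (hT C) //; apply/mapP; exists (v, s).
Qed.

Lemma raw_wf n (F : cnf n) : uniq (raw F) -> all uniq (raw F) -> cnf_wf F.
Proof.
move=> uF aF; apply/andP; split; first exact: map_uniq uF.
by apply/allP => C CF; apply: map_uniq (allP aF _ (map_f _ CF)).
Qed.

Lemma uniq_raw n (F : cnf n) : cnf_wf F -> uniq (raw F) /\ all uniq (raw F).
Proof.
have inj : injective (fun l : literal n => (val l.1, l.2)).
  by move=> [v s] [v' s'] [/val_inj -> ->].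
move=> /andP[uF /allP aF]; split.
- by rewrite map_inj_uniq //; exact: inj_map.
- by apply/allP => _ /mapP[C CF ->]; rewrite map_inj_uniq // aF.
Qed.

Lemma satisfies_conj n (a : {ffun 'I_n -> bool}) (S : {set 'I_n}) :
  satisfies a (conj_of S) <-> (forall i, i \in S -> a i).
Proof.
rewrite /satisfies /conj_of all_map; split=> [/allP h i iS|h].
- by have := h i; rewrite mem_enum => /(_ iS) /=; rewrite orbF => /eqP.
- by apply/allP => i; rewrite mem_enum => /h /= ->.
Qed.

Lemma satisfies_cat n (a : {ffun 'I_n -> bool}) (F G : cnf n) :
  satisfies a (F ++ G) = satisfies a F && satisfies a G.
Proof. exact: all_cat. Qed.

Lemma enc_set_pred n (p : pred nat) :
  enc_set [set i : 'I_n | p i] = enc_nats [seq v <- iota 0 n | p v].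
Proof.
rewrite /enc_set /enc_nats -val_enum_ord filter_map.
rewrite (_ : enum [set i : 'I_n | p i] = [seq i <- enum 'I_n | p (val i)]).
  have enc_val (s : seq 'I_n) :
      enc_seq (@enc_ord n) s = enc_seq enc_nat (map val s).
    by elim: s => //= i s ->.
  exact: enc_val.
by rewrite enumT {1}/enum_mem; apply: eq_filter => i; rewrite /= inE.
Qed.

Lemma slots_uniq (ss : seq nat) N :
  [seq s <- iota 0 16 | s \in ss] = ss -> uniq (slots ss (iota 0 N)).
Proof. by move=> /slots_iota ->; rewrite filter_uniq ?iota_uniq. Qed.

Lemma size_slots ss l : size (slots ss l) = size ss * size l.
Proof. by elim: l => [|j l ih] /=; rewrite ?size_cat ?size_map ?ih; lia. Qed.

(** The successor accounts for the additional first block of [blocks F]. *)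
Definition rounds (F : seq (seq lit)) : nat := up_log 2 (size F).+1.

(** The last condition ensures that the [8 * N] addressing variables can tell the [(size F).+1]
    blocks apart. *)
Definition admissible (N : nat) (F : seq (seq lit)) : Prop :=
  [/\ 0 < N, all uniq F, forall C l, C \in F -> l \in C -> l.1 < N
    & size F < 2 ^ (8 * N)].

(** Well-formedness, treewidth and semantics of the theory are all derived from this description of
    the final block. *)
Lemma tournament_spec N F :
  admissible N F ->
  exists us A,
  [/\ tournament (slots (iota 8 8) (iota 0 N)) (blocks F) = [:: A],
      size us <= rounds F, block_ok N us A,
      forall v, v \in us -> 8 <= v %% 16 /\ v < 16 * N
    & forall h, h manifestation = false -> (escapes h A <->
        exists2 C, C \in F & forall l, l \in C -> h (hyp_of l) = false)].
Proof.
move=> [N0 uF hF sF]; set bs := slots _ _; set r := rounds F.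
have bits v : v \in bs -> 8 <= v %% 16 /\ v < 16 * N.
  by rewrite mem_slots // !mem_iota; lia.
have sz : 0 < size (blocks F) <= 2 ^ r.
  by rewrite /= size_map up_logP.
have r_le : r <= size bs.
  by rewrite size_slots !size_iota; apply: up_log_min.
have ubs : uniq (take r bs) by apply/take_uniq/slots_uniq.
have hbs b : b \in take r bs -> 8 <= b %% 16 by move=> /mem_take/bits[].
have hus b : b \in take r bs -> b \notin [::] by [].
have spec h := tournament_correct h ubs hbs hus (blocks_ok N0 uF hF).
rewrite (tournament_take sz r_le).
have := @size_tournament (take r bs) (blocks F).
rewrite size_takel // => /(_ sz).
case: (tournament _ _) spec => [//|A [|//]] spec _.
exists (catrev (take r bs) [::]), A; split=> //.
- by rewrite -[catrev _ _]/(rev _) size_rev size_takel.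
(* This half of [spec] does not depend on the valuation, so any one serves. *)
- by have [+ _] := spec xpredT; apply; rewrite mem_head.
- by move=> v; rewrite -[catrev _ _]/(rev _) mem_rev => /mem_take/bits.
- move=> h hm; rewrite -(escapes_blocks _ hm); have [_ <-] := spec h.
  split=> [hA|[B]]; first by exists A => //; rewrite mem_head.
  by rewrite inE => /eqP ->.
Qed.

Lemma theory_bounded N F C v :
  admissible N F ->
  C \in theory (iota 0 N) F -> v \in unzip1 C -> v < 16 * N.
Proof.
move=> ok; have [us [A [eA _ [_ _ _ shape] hus _]]] :=
  tournament_spec ok.
rewrite /theory eA mem_cat => /orP[/mapP[j + ->]|].
  rewrite mem_iota !inE /= /slot => jN /orP[] /eqP ->; lia.
rewrite /= cats0 => /shape[j jN hC] /hC[/hus[]//|->|->|->] ;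
  rewrite /manifestation /slot; lia.
Qed.

Lemma theory_uniq N F :
  admissible N F ->
  uniq (theory (iota 0 N) F) /\ all uniq (theory (iota 0 N) F).
Proof.
move=> ok; have [us [A [eA _ [uA aA mA _] _ _]]] :=
  tournament_spec ok.
rewrite /theory eA /= cats0; split.
- rewrite cat_uniq uA andbT map_inj_uniq ?iota_uniq /=; last first.
    by move=> j j' []; rewrite /slot; lia.
  (* Conflict clauses are purely negative, while each clause of [A] contains the manifestation
     positively. *)
  apply/hasPn => C /mA mC; apply/mapP => -[j _ eC].
  by move: mC; rewrite eC !inE !xpair_eqE !andbF.
- rewrite all_cat aA andbT; apply/allP => _ /mapP[j _ ->] /=.
  by rewrite inE xpair_eqE andbT andbT /slot; lia.
Qed.

(** * The abduction problem and its treewidth *)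

(** Every edge joins the centre [None] to a leaf, so along a cycle of length at least 3 the centre
    would come back or two leaves would be adjacent. *)
Lemma star_is_tree (J : finType) :
  @is_tree (option J) (fun x y => (x == None) != (y == None)).
Proof.
split.
- by move=> x y; rewrite eq_sym.
- by move=> x; rewrite eqxx.
- by rewrite card_option.
- have h x : connect (fun x y : option J => (x == None) != (y == None)) x None.
    by case: x => [j|]; [exact: connect1|exact: connect0].
  move=> x y; apply: connect_trans (h x) _.
  by case: y => [j|]; [exact: connect1|exact: connect0].
- move=> [|x [|y [|z s]]] // /andP[] /=.
  case: x y z s => [x|] [y|] [z|] s //=; rewrite ?andbF ?inE //=.
  by case: s => [|[t|] s] //=; rewrite !inE ?orbT ?andbF.
Qed.

(** [K] separates the classes of [cl]: it is the bag at the centre of a star, and leaf [j] adds the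
    class of [j]. *)
Lemma treewidth_star (V J : finType) (adj : rel V) (K : {set V}) (cl : V -> J) w :
  (forall u v, adj u v -> [|| u \in K, v \in K | cl u == cl v]) ->
  0 < #|J| ->
  (forall j, #|K :|: [set v | cl v == j]| <= w.+1) ->
  treewidth adj <= w.
Proof.
move=> hadj hJ hw; rewrite /treewidth; case: ex_minnP => m _; apply.
apply/asboolP; exists (option J), (fun x y => (x == None) != (y == None)).
exists (fun x => if x is Some j then K :|: [set v | cl v == j] else K).
split; last first.
  case=> [j|]; first exact: hw.
  have /card_gt0P[j _] := hJ; apply: leq_trans (hw j).
  by rewrite subset_leq_card // finset.subsetUl.
split=> [|v|u v /hadj|v i j vi vj]; first exact: star_is_tree.
- by exists (Some (cl v)); rewrite !inE eqxx orbT.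
- by case/or3P=> [uK|vK|/eqP huv]; [exists (Some (cl v))|exists (Some (cl u))
    |exists (Some (cl u))]; rewrite !inE ?uK ?vK ?huv eqxx ?orbT.
(* A vertex of [K] lies in all bags, which are connected through the centre; any other vertex lies
   in one bag only. *)
have [vK|vK] := boolP (v \in K).
  set e := (fun x y : option J => _).
  have h x : connect e x None.
    case: x => [k|]; last exact: connect0.
    by apply: connect1; rewrite /e /= !inE vK.
  have h' x : connect e None x.
    case: x => [k|]; last exact: connect0.
    by apply: connect1; rewrite /e /= !inE vK.
  exact: connect_trans (h i) (h' j).
case: i j vi vj => [i|] [j|]; rewrite ?inE ?(negbTE vK) //=.
by move=> /eqP -> /eqP ->; exact: connect0.
Qed.

Lemma card_le_size (U : finType) (A : {set U}) (s : seq U) :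
  {subset A <= s} -> #|A| <= size s.
Proof.
move=> h; apply: leq_trans (card_size s); apply: subset_leq_card.
exact/fintype.subsetP.
Qed.

Section PapOfCnf.
Variables (N : nat) (F : seq (seq lit)).
Hypothesis ok : admissible N F.

(** [inord] needs a successor; since [N] is positive, [n.+1] is [16 * N]. *)
Let n := (16 * N).-1.
Let T := theory (iota 0 N) F.

Let nE : n.+1 = 16 * N.
Proof. by case: ok; rewrite /n; lia. Qed.

Let raw_T : raw (unraw n T) = T.
Proof. by apply: unrawK => C v CT vC; rewrite nE (theory_bounded ok CT vC). Qed.

Let wf_T : cnf_wf (unraw n T).
Proof. by have [uT aT] := theory_uniq ok; apply: raw_wf; rewrite raw_T. Qed.

Definition pap_of_cnf : pap :=
  @Pap n.+1 [set i : 'I_n.+1 | val i %% 16 \in [:: 0; 1; 3]]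
    [set i : 'I_n.+1 | val i == manifestation] (unraw n T) wf_T.

Lemma pap_of_cnf_nvars : pap_nvars pap_of_cnf = 16 * N.
Proof. exact: nE. Qed.

Lemma enc_pap_of_cnf : enc_pap pap_of_cnf =
  enc_raw_pap (slots (iota 0 16) (iota 0 N),
    (slots [:: 0; 1; 3] (iota 0 N), ([:: manifestation], T))).
Proof.
have N0 : 0 < N by case: ok.
have encP (p : pred nat) : enc_set [set i : 'I_n.+1 | p (val i)]
    = enc_nats [seq v <- iota 0 (16 * N) | p v] by rewrite enc_set_pred nE.
rewrite /enc_pap /enc_raw_pap /enc_pair; congr (Node _ (Node _ (Node _ _))).
- have -> : [set: 'I_n.+1] = [set i : 'I_n.+1 | val i %% 16 \in iota 0 16].
    apply/finset.setP => i; rewrite finset.in_setT [RHS]finset.in_set.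
    by rewrite mem_iota /= ltn_mod.
  apply: etrans (encP (fun v => v %% 16 \in iota 0 16)) _.
  by congr enc_nats; apply/esym/slots_iota.
- apply: etrans (encP (fun v => v %% 16 \in [:: 0; 1; 3])) _.
  by congr enc_nats; apply/esym/slots_iota.
- apply: etrans (encP (pred1 manifestation)) _.
  rewrite filter_pred1_uniq ?iota_uniq //.
  by rewrite mem_iota /manifestation; lia.
- by rewrite enc_cnf_raw raw_T.
Qed.

(** A bag consists of at most [rounds F] addressing variables in use, the manifestation, and the 16
    slots of one variable; the width is one less than this sum. *)
Lemma pap_of_cnf_tw : pap_tw pap_of_cnf <= rounds F + 16.
Proof.
have N0 : 0 < N by case: ok.
have [us [A [eA s_us [_ _ _ shape] _ _]]] := tournament_spec ok.
rewrite /pap_tw /primal_treewidth /=.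
pose K := [set i : 'I_n.+1 | (val i \in us) || (val i == manifestation)].
pose cl (i : 'I_n.+1) : 'I_n.+1 := inord (val i %/ 16).
have clE i : val (cl i) = val i %/ 16 by rewrite /cl /= inordK //; have := ltn_ord i; lia.
apply: (@treewidth_star _ _ _ K cl).
- move=> u v /andP[_ /hasP[C CT /andP[uC vC]]].
  pose C' : seq lit := [seq (val l.1, l.2) | l <- C].
  have memC' (w : 'I_n.+1) : w \in unzip1 C -> val w \in unzip1 C'.
    by move=> /mapP[l lC ->]; apply/mapP; exists (val l.1, l.2) => //; apply/mapP; exists l.
  have : C' \in T by rewrite -raw_T; apply/mapP; exists C.
  rewrite /T /theory eA /= cats0 mem_cat => /orP[/mapP[j _ eC]|/shape[j jN hC]].
  + have clj (w : 'I_n.+1) : w \in unzip1 C -> val w %/ 16 = j.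
      by move=> /memC'; rewrite eC !inE /slot => /orP[] /eqP /= ->; lia.
    by apply/or3P/Or33/eqP/val_inj; rewrite !clE !clj.
  + have clj (w : 'I_n.+1) : w \in unzip1 C -> (w \in K) || (val w %/ 16 == j).
      move=> /memC'/hC; rewrite !inE => -[->|->|->|->]; rewrite ?eqxx ?orbT //.
      * by apply/orP; right; rewrite /slot; lia.
      * by apply/orP; right; rewrite /slot; lia.
    have /orP[->//|/eqP hu] := clj _ uC; have /orP[->|/eqP hv] := clj _ vC.
      by rewrite orbT.
    by apply/or3P/Or33/eqP/val_inj; rewrite !clE hu hv.
- by rewrite card_ord.
- move=> j; apply: leq_trans (leq_card_setU _ _) _.
  have -> : (rounds F + 16).+1 = (rounds F).+1 + 16 by lia.
  apply: leq_add.
  + pose s : seq 'I_n.+1 := [seq inord v | v <- manifestation :: us].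
    have sub : {subset K <= s}.
      move=> i; rewrite inE => hi; apply/mapP; exists (val i); last by rewrite inord_val.
      by rewrite inE orbC.
    by apply: leq_trans (card_le_size sub) _; rewrite size_map /= ltnS.
  + pose s : seq 'I_n.+1 := [seq inord (slot t (val j)) | t <- iota 0 16].
    have sub : {subset [set v | cl v == j] <= s}.
      move=> i; rewrite inE => /eqP hi; apply/mapP; exists (val i %% 16).
        by rewrite mem_iota /= ltn_mod.
      by rewrite -hi clE /slot addnC mulnC -divn_eq inord_val.
    by apply: leq_trans (card_le_size sub) _; rewrite size_map size_iota.
Qed.

Let slot_lt s j : s < 16 -> j < N -> slot s j < n.+1.
Proof. by rewrite nE /slot; lia. Qed.

Let v3 : 'I_n.+1 := inord 3.

Let val_v3 : val v3 = 3.
Proof. by rewrite /v3 /= inordK // nE; case: ok; lia. Qed.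

(** The hypothesis [v3] occurs in no clause and may be included or omitted at will. Relevance takes
    [b = true], necessity takes [b = false]. *)
Lemma solution_of_assignment (a : nat -> bool) (b : bool) :
  sat_clauses a F ->
  exists2 S : {set 'I_(pap_nvars pap_of_cnf)}, is_solution S &
    (v3 \in S) = b.
Proof.
move=> aF; have [N0 _ hF _] := ok.
have [us [A [eA _ [_ _ mA _] _ spec]]] := tournament_spec ok.
(* The model that proves consistency: the literal slots follow [a] and all else is true, in
   particular the manifestation, which satisfies every clause of [A]. *)
pose g v := if v %% 16 == 0 then a (v %/ 16)
            else if v %% 16 == 1 then ~~ a (v %/ 16) else true.
pose p v := [|| (v %% 16 == 0) && g v, (v %% 16 == 1) && g v | (v == 3) && b].
exists [set i : 'I_n.+1 | p (val i)]; last by rewrite inE val_v3.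
have slot0 j : (slot 0 j %% 16 = 0) * (slot 0 j %/ 16 = j).
  by split; rewrite /slot; lia.
have slot1 j : (slot 1 j %% 16 = 1) * (slot 1 j %/ 16 = j).
  by split; rewrite /slot; lia.
split.
- apply/fintype.subsetP => i; rewrite !inE /p => /or3P[] /andP[/eqP -> _] //.
- exists [ffun i : 'I_n.+1 => g (val i)]; rewrite satisfies_cat; apply/andP; split.
    rewrite satisfies_raw_ffun raw_T /T /theory eA /= cats0 sat_clauses_cat.
    apply/andP; split; last first.
      apply/allP => C /mA hC; apply/hasP; by exists (manifestation, true).
    apply/allP => _ /mapP[j _ ->].
    rewrite /= /sat_lit /= /g !(slot0 j) !(slot1 j) /=.
    by case: (a j).
  apply/satisfies_conj => i; rewrite inE ffunE /p => /or3P[/andP[]|/andP[]|] //.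
  by move=> /andP[/eqP ei _]; rewrite /g ei.
- move=> f; rewrite satisfies_cat => /andP[fT /satisfies_conj fS].
  apply/satisfies_conj => i; rewrite inE => /eqP im.
  (* A model without the manifestation escapes [A], so some clause of [F] has no literal true in it;
     but [S] asserts the literal that [a] satisfies. *)
  apply/negPn/negP => fi.
  move: fT; rewrite satisfies_raw raw_T /T /theory eA /= cats0 sat_clauses_cat.
  set h := (fun v => _) => /andP[_ hA].
  have hm : h manifestation = false.
    by rewrite /h -im inord_val; exact: negbTE.
  have [|C CF hC] := (spec h hm).1; first by exists h.
  have /hasP[l lC al] := allP aF _ CF.
  have := hC _ lC; rewrite /h fS // inE /p /=.
  have lN := hF _ _ CF lC.
  rewrite /hyp_of; move: al; rewrite /sat_lit; case: l.2 => /eqP al.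
  + by rewrite inordK ?slot_lt // /g !slot0 /= al.
  + by rewrite inordK ?slot_lt // /g !slot1 /= al.
Qed.

(** If the assignment read off from [S] violated a clause, an address of that clause together with
    the truth values of [S] would be a model of the theory and [S] without the manifestation. *)
Lemma assignment_of_solution (S : {set 'I_(pap_nvars pap_of_cnf)}) :
  is_solution S -> exists a : nat -> bool, sat_clauses a F.
Proof.
move=> [/fintype.subsetP SH [f]]; have [N0 _ hF _] := ok.
have [us [A [eA _ _ hus spec]]] := tournament_spec ok.
rewrite satisfies_cat satisfies_raw /= raw_T => /andP[fT /satisfies_conj fS] ent.
have conflict j : j < N -> ~~ ((inord (slot 0 j) \in S) && (inord (slot 1 j) \in S)).
  move=> jN; apply/negP => /andP[/fS f0 /fS f1].
  move: fT; rewrite sat_clauses_cat => /andP[/allP + _].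
  move=> /(_ [:: (slot 0 j, false); (slot 1 j, false)] _)/wrap[].
    by apply/mapP; exists j => //; rewrite mem_iota.
  by rewrite /= /sat_lit /= f0 f1.
exists (fun j => inord (slot 0 j) \in S).
apply/negPn/negP => /allPn[C CF /hasPn hC].
pose h v := (v < n.+1) && ((inord v : 'I_n.+1) \in S).
have hm : h manifestation = false.
  apply/negP => /andP[mn /SH]; rewrite inE /= inordK //.
have [|g [gh gA]] := (spec h hm).2.
  exists C => // l lC; have lN := hF _ _ CF lC.
  have := hC _ lC; rewrite /h /hyp_of /sat_lit; case: l.2.
  + by rewrite slot_lt // => /eqP; case: (_ \in S).
  (* The assignment looks at [slot 0 j] only; a violated negative literal is not asserted because
     [S] has no conflicts. *)
  + rewrite slot_lt // => h0; have := conflict _ lN.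
    by move: h0; case: (_ \in S) => //= _ /negbTE.
have gS (i : 'I_n.+1) : i \in S -> g (val i) = true.
  move=> iS; rewrite gh ?/h ?inord_val ?iS ?ltn_ord //.
  by have := SH _ iS; rewrite !inE => /or3P[] /eqP ->.
have gC : sat_clauses g (conflicts (iota 0 N)).
  apply/allP => _ /mapP[j + ->]; rewrite mem_iota /= => jN.
  have s8 s : s < 8 -> slot s j %% 16 < 8 by rewrite /slot; lia.
  rewrite /= /sat_lit /= (gh _ (s8 0 isT)) (gh _ (s8 1 isT)) /h.
  rewrite (@slot_lt 0) // (@slot_lt 1) //=.
  by have := conflict _ jN; case: (_ \in S); case: (_ \in S).
have := ent [ffun i : 'I_n.+1 => g (val i)].
rewrite satisfies_cat satisfies_raw_ffun /= raw_T /T /theory eA /= cats0.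
rewrite sat_clauses_cat gC gA /= => /(_ _)/wrap[].
  by apply/satisfies_conj => i iS; rewrite ffunE gS.
move=> /satisfies_conj/(_ (inord manifestation)).
have mn : manifestation < n.+1 by rewrite nE /manifestation; lia.
rewrite inE ffunE /= inordK // eqxx gh // hm => /(_ isT).
by [].
Qed.

Lemma v3_hyp : v3 \in pap_H pap_of_cnf.
Proof. by rewrite inE val_v3. Qed.

Definition pap_hyp_of_cnf : pap_hyp := @PapHyp pap_of_cnf v3 v3_hyp.

Lemma enc_pap_hyp_of_cnf :
  enc_pap_hyp pap_hyp_of_cnf = Node (enc_pap pap_of_cnf) (enc_nat 3).
Proof. by rewrite /enc_pap_hyp /enc_ord /= -/v3 [nat_of_ord v3]val_v3. Qed.

Lemma pap_of_cnf_correct :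
  [/\ solvable_pap pap_of_cnf <-> exists a, sat_clauses a F,
      relevant pap_hyp_of_cnf <-> exists a, sat_clauses a F
    & necessary pap_hyp_of_cnf <-> ~ exists a, sat_clauses a F].
Proof.
split; split.
- by move=> [S /assignment_of_solution].
- by move=> [a /(solution_of_assignment true)[S hS _]]; exists S.
- by move=> [S [/assignment_of_solution]].
- by move=> [a /(solution_of_assignment true)[S hS hv]]; exists S.
- by move=> nec [a /(solution_of_assignment false)[S /nec hS]]; rewrite hS.
- by move=> nsat S /assignment_of_solution /nsat.
Qed.

End PapOfCnf.

(** * From 3SAT to abduction by a program *)

(** A decision program is specified only on stores that are [Leaf] outside register 0. Before it
    starts, the scratch registers of the reduction have to be erased, and [max_reg] bounds them. *)
Fixpoint max_reg (c : cmd) : nat :=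
  match c with
  | Skip => 0
  | Assign x _ => x
  | Seq c1 c2 | If _ c1 c2 => maxn (max_reg c1) (max_reg c2)
  | While _ c1 => max_reg c1
  end.

Lemma exec_max_reg c s t s' y :
  exec c s t s' -> max_reg c < y -> s' y = s y.
Proof.
elim=> {c s t s'} //=.
- by move=> s x e xy; rewrite /update gtn_eqF.
- move=> c1 c2 s1 s2 s3 t1 t2 _ ih1 _ ih2; rewrite gtn_max => /andP[h1 h2].
  by rewrite ih2 // ih1.
- move=> e c1 c2 s s' t _ ih; rewrite gtn_max => /andP[h1 h2]; apply: ih.
  by case: ifP.
- by move=> e c s1 s2 s3 t1 t2 _ _ ih1 _ ih2 h; rewrite ih2 // ih1.
Qed.

Fixpoint clear (K : nat) : cmd :=
  if K is k.+1 then Seq (Assign k.+1 Nil) (clear k) else Skip.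

Lemma run_clear K s :
  run (clear K) s (3 * K + 1)
    (fun s' => forall y, s' y = if 0 < y <= K then Leaf else s y).
Proof.
elim: K s => [|K ih] s /=.
  by exists 1, s; split; [exact: ExecSkip| |case].
apply: (run_weaken (T := (2 + (3 * K + 1)).+1) (P := fun s' => forall y,
    s' y = if 0 < y <= K then Leaf else update s K.+1 Leaf y)).
- exact: run_assign_seq.
- by lia.
- move=> s' h y; rewrite h /update; case: eqP => [->|ne].
    by rewrite ltnn andbF leqnn.
  by rewrite [y <= K.+1]leq_eqVlt ltnS; case: eqP => // e; lia.
Qed.

Lemma polytime_run (A B : Type) (eA : A -> tree) (eB : B -> tree) (f : A -> B) :
  polytime eA eB f -> exists c k C, forall x,
    run c (input_store (eA x)) (tsize (eA x) ^ k + C)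
      (fun s' => s' = input_store (eB (f x))).
Proof.
move=> [k [_ /(_ 0)[c hc]]].
exists (Seq c (clear (max_reg c))), k, (3 * max_reg c + 2) => x.
have [|t [s1 [ex1 le1 [s10 _]]]] := hc (input_store (eA x)) x; first by [].
have [t2 [s2 [ex2 le2 h2]]] := run_clear (max_reg c) s1.
exists (t + t2).+1, s2; split; first exact: ExecSeq ex1 ex2.
  by lia.
apply: funext => y; rewrite h2 /input_store; case: y => [|y] //=.
case: ltnP => // hy; exact: (exec_max_reg ex1).
Qed.

Lemma decides_by_reduction (R : realType) (A B I : Type) (eA : A -> tree)
    (eB : B -> tree) (f : A -> B) (enc : I -> tree) (X : A -> I)
    (yes : I -> Prop) (bound : I -> R) (c : cmd) :
  polytime eA eB f -> (forall a, enc (X a) = eB (f a)) ->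
  decides_in_time enc yes bound c ->
  exists c' k C, decides_in_time eA (fun a => yes (X a))
    (fun a => ((tsize (eA a) ^ k + C)%:R + bound (X a))%R) c'.
Proof.
move=> /polytime_run[c0 [k [C h0]]] hX dec.
exists (Seq c0 c), k, C.+1 => a.
have [t1 [s1 [ex1 le1 es1]]] := h0 a; rewrite es1 -hX in ex1.
have [t2 [s [ex2 ans le2]]] := dec (X a).
exists (t1 + t2).+1, s; split=> //; first exact: ExecSeq ex1 ex2.
rewrite -addn1 addnAC natrD lerD // ler_nat.
by rewrite addn1 addnS ltnS.
Qed.

Lemma decides_negation (R : realType) (I : Type) (enc : I -> tree)
    (yes : I -> Prop) (bound : I -> R) (c : cmd) :
  decides_in_time enc yes bound c ->
  exists c', decides_in_time enc (fun x => ~ yes x)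
    (fun x => (7%:R + bound x)%R) c'.
Proof.
move=> dec.
exists (Seq c (If (Var 0) (Assign 0 Nil) (Assign 0 (Cons Nil Nil)))) => x.
have [t1 [s [ex1 ans le1]]] := dec x.
have [t2 [s' [ex2 le2 hs']]] :
    run (If (Var 0) (Assign 0 Nil) (Assign 0 (Cons Nil Nil))) s (1 + 4).+1
      (fun s' => is_true_tree (s' 0) = ~~ is_true_tree (s 0)).
  apply: run_if => /=; case: ifP => s0; last exact: run_assign.
  set P := fun s' => _; apply: (run_weaken (T := 2) (P := P)) => //.
  exact: run_assign.
exists (t1 + t2).+1, s'; split=> //; first exact: ExecSeq ex1 ex2.
  rewrite hs'; split=> [/negP hn /ans //|hn]; apply/negP => /ans; exact: hn.
apply: (@le_trans _ _ (7%:R + t1%:R)%R); last by rewrite lerD2l.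
by rewrite -natrD ler_nat; lia.
Qed.

(** * The instance obtained from a 3CNF and its size *)

Lemma size_3cnf N (F : cnf N) : uniq F -> all (fun C => size C <= 3) F ->
  size F <= (2 * N + 1) ^ 3.
Proof.
move=> uF /allP F3.
(* A clause of at most three literals is determined by three optional literals, each with
   [2 * N + 1] values. *)
pose f (C : clause N) :=
  (ohead C, (ohead (behead C), ohead (behead (behead C)))).
have uf : uniq (map f F).
  rewrite map_inj_in_uniq // => C C' /F3 + /F3.
  by case: C C' => [|a [|b [|c [|? ?]]]] [|a' [|b' [|c' [|? ?]]]] //=;
    rewrite /f /= => _ _ [] // *; congruence.
rewrite -(size_map f) -(card_uniqP uf); apply: leq_trans (max_card _) _.
rewrite !card_prod !card_option card_prod card_ord card_bool !expnS.
by lia.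
Qed.

Definition raw3 (G : cnf3) : seq nat * seq (seq lit) :=
  (iota 0 (cnf3_nvars G), raw (cnf3_cnf G)).

Lemma enc_cnf3_raw3 G : enc_cnf3 G = enc_pair enc_nats enc_clauses (raw3 G).
Proof.
rewrite /enc_cnf3 enc_cnf_raw; congr Node.
rewrite (_ : [set: _] = [set i : 'I_(cnf3_nvars G) | predT (val i)]).
  by rewrite enc_set_pred filter_predT.
by apply/finset.setP => i; rewrite !finset.inE.
Qed.

Lemma size_cnf3 G : size (cnf3_cnf G) <= (2 * cnf3_nvars G + 1) ^ 3.
Proof. by case: G => n F /= /andP[/andP[uF _] F3]; apply: size_3cnf. Qed.

(** Eight addressing variables per variable are generous, but with the eight slots below them they
    complete the power of two 16. *)
Lemma cube_lt_exp N : (2 * N + 1) ^ 3 < 2 ^ (8 * maxn N 1).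
Proof.
case: N => [|N]; first by [].
rewrite (maxn_idPl _) // expnM; elim: N => [//|N ih].
rewrite [X in _ < X]expnS; apply: (@leq_trans (256 * (2 * N.+1 + 1) ^ 3)).
  by rewrite !expnS !expn0; nia.
by rewrite leq_pmul2l // ltnW.
Qed.

Lemma admissible_cnf3 G : admissible (maxn (cnf3_nvars G) 1) (raw (cnf3_cnf G)).
Proof.
split.
- by rewrite leq_max orbT.
- by case: G => n F /= /andP[wF _]; have [] := uniq_raw wF.
- move=> _ _ /mapP[C _ ->] /mapP[l _ ->] /=.
  by apply: leq_trans (ltn_ord _) (leq_maxl _ _).
- rewrite size_map; apply: leq_ltn_trans (cube_lt_exp _).
  exact: size_cnf3.
Qed.

Definition pap_of_cnf3 (G : cnf3) : pap_hyp :=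
  pap_hyp_of_cnf (admissible_cnf3 G).

Lemma pad_iota N : pad (iota 0 N) = iota 0 (maxn N 1).
Proof. by case: N => [//|N]; rewrite (maxn_idPl _). Qed.

Lemma enc_pap_of_cnf3 G :
  enc_pap (ph_pap (pap_of_cnf3 G)) = enc_raw_pap (reduction (raw3 G)).
Proof. by rewrite enc_pap_of_cnf /reduction /= pad_iota. Qed.

Lemma enc_pap_hyp_of_cnf3 G : enc_pap_hyp (pap_of_cnf3 G)
  = enc_pair enc_raw_pap enc_nat (reduction (raw3 G), 3).
Proof. by rewrite enc_pap_hyp_of_cnf enc_pap_of_cnf3. Qed.

Lemma sat3_raw G : sat3 G <-> exists a, sat_clauses a (raw (cnf3_cnf G)).
Proof.
case: G => n F hF; rewrite /sat3 /=; split=> [[a]|[a ha]]; last first.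
  by exists [ffun i : 'I_n => a (val i)]; rewrite satisfies_raw_ffun.
move=> sat_a; exists (fun v => if insub v is Some i then a i else true).
rewrite -satisfies_raw_ffun; congr (is_true (satisfies _ _)) : sat_a.
by apply/ffunP => i; rewrite ffunE valK.
Qed.

Lemma pap_of_cnf3_correct G :
  [/\ solvable_pap (ph_pap (pap_of_cnf3 G)) <-> sat3 G,
      relevant (pap_of_cnf3 G) <-> sat3 G
    & necessary (pap_of_cnf3 G) <-> ~ sat3 G].
Proof.
have [h1 h2 h3] := pap_of_cnf_correct (admissible_cnf3 G).
by split; rewrite ?h1 ?h2 ?h3 sat3_raw.
Qed.

Lemma pap_of_cnf3_nvars G :
  pap_nvars (ph_pap (pap_of_cnf3 G)) = 16 * maxn (cnf3_nvars G) 1.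
Proof. exact: pap_of_cnf_nvars. Qed.

(** Logarithmic treewidth, stated without logarithms. The factor 2 comes from rounding up the
    logarithm, [8 * N.+1 ^ 3] from counting clauses, [2 ^ 16] from the slots of a bag; the constants
    multiply to [2 ^ 20 = 32 ^ 4]. *)
Lemma pap_of_cnf3_tw G :
  2 ^ pap_tw (ph_pap (pap_of_cnf3 G)) <= (32 * (cnf3_nvars G).+1) ^ 4.
Proof.
set N := cnf3_nvars G.
have := pap_of_cnf_tw (admissible_cnf3 G); set F := raw _ => htw.
have sF : (size F).+1 <= 8 * N.+1 ^ 3.
  have := size_cnf3 G; rewrite /F size_map -/N => h.
  by apply: leq_ltn_trans h _; rewrite !expnS !expn0; nia.
apply: (@leq_trans (2 ^ (rounds F + 16))); first by rewrite leq_exp2l.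
have hr : 2 ^ rounds F <= 2 * (size F).+1.
  rewrite /rounds; case: (posnP (size F)) => [->|F0]; first by [].
  have /andP[h _] := up_log_bounds (isT : 1 < 2) (F0 : 1 < (size F).+1).
  case: up_log h => [//|r] /= h.
  by rewrite expnS leq_mul2l ltnW.
rewrite expnD.
apply: (@leq_trans (2 * (8 * N.+1 ^ 3) * 2 ^ 16)).
  by rewrite leq_mul2r (leq_trans hr) // leq_mul2l sF.
have -> : 2 * (8 * N.+1 ^ 3) * 2 ^ 16 = 32 ^ 4 * N.+1 ^ 3.
  have -> : 32 = 2 ^ 5 by [].
  have -> : 8 = 2 ^ 3 by [].
  by rewrite -!expnM mulnA -expnS mulnAC -expnD.
by rewrite expnMn leq_mul2l leq_pexp2l ?orbT.
Qed.

Lemma tsize_enc_nat n : tsize (enc_nat n) <= 6 * n + 2.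
Proof.
rewrite /enc_nat -{2}[n]bin_of_natK; case: (bin_of_nat n) => [//|p] /=.
have p0 q : 0 < nat_of_pos q by elim: q => //= q; rewrite NatTrec.doubleE double_gt0.
have : tsize (enc_pos p) <= 6 * nat_of_pos p.
  elim: p => [q|q|] //=; rewrite NatTrec.doubleE; have := p0 q; lia.
lia.
Qed.

Lemma tsize_enc_seq (T : eqType) (eT : T -> tree) (s : seq T) m :
  (forall x, x \in s -> tsize (eT x) <= m) ->
  tsize (enc_seq eT s) <= size s * m + 2.
Proof.
elim: s => //= x s ih h; rewrite mulSn -addnA leq_add ?h ?mem_head //.
by apply: ih => y ys; apply: h; rewrite inE ys orbT.
Qed.

Lemma tsize_enc_cnf3 G : tsize (enc_cnf3 G) <= (200 * (cnf3_nvars G).+1) ^ 4.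
Proof.
set N := cnf3_nvars G; rewrite enc_cnf3_raw3 /=.
have h1 : tsize (enc_nats (iota 0 N)) <= N * (6 * N + 2) + 2.
  apply: leq_trans (@tsize_enc_seq _ enc_nat (iota 0 N) (6 * N + 2) _) _.
    move=> v; rewrite mem_iota => vN; apply: leq_trans (tsize_enc_nat v) _; lia.
  by rewrite size_iota.
have hC C : C \in raw (cnf3_cnf G) ->
    tsize (enc_clause C) <= 3 * (6 * N + 6) + 2.
  move=> CF; apply: leq_trans (@tsize_enc_seq _ enc_lit C (6 * N + 6) _) _.
    move=> [v b] lC; have vN : v < N.
      by move: CF lC => /mapP[D _ ->] /mapP[m _ [-> _]] /=.
    rewrite /enc_lit /=; have := tsize_enc_nat v.
    by case: b {lC} => /=; lia.
  rewrite leq_add2r leq_mul2r; apply/orP; right.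
  move: CF => /mapP[D DF ->]; rewrite size_map.
  by case: G D DF @N h1 => n F /= /andP[_ /allP F3] D /F3.
have h2 := tsize_enc_seq hC; rewrite size_map in h2.
have h3 := size_cnf3 G; rewrite -/N in h3.
apply: (@leq_trans (N * (6 * N + 2) + 2 +
   ((2 * N + 1) ^ 3 * (3 * (6 * N + 6) + 2) + 2))).
  apply: leq_add => //; apply: leq_trans h2 _.
  by rewrite leq_add2r leq_mul2r h3 orbT.
rewrite !expnS !expn0 !muln1; nia.
Qed.

(** * Subexponential bounds *)

Local Open Scope ring_scope.

Section Subexponential.
Variable R : realType.
Implicit Types (f g : nat -> R) (eps : R).

Lemma little_o_id_le f eps : little_o_id f -> 0 < eps ->
  exists C, forall n, f n <= eps * n%:R + C.
Proof.
move=> /eqoP fo eps0; have [N _ hN] := fo _ eps0.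
(* The sum absorbs the finitely many values before the asymptotic bound sets in. *)
exists (\sum_(i < N) `|f i|) => n; have [nN|Nn] := ltnP n N.
  apply: (le_trans (ler_norm _)); rewrite (bigD1 (Ordinal nN)) //= addrCA lerDl.
  by rewrite addr_ge0 ?mulr_ge0 ?ler0n ?(ltW eps0) // sumr_ge0.
apply: (le_trans (ler_norm _)); apply: (le_trans (hN n Nn)).
by rewrite normr_nat lerDl sumr_ge0.
Qed.

Lemma two_powRE (x : R) : 2 `^ x = expR (x * ln 2).
Proof. by rewrite /powR pnatr_eq0. Qed.

Lemma ln2_gt0 : 0 < ln 2 :> R.
Proof. by rewrite ln_gt0 // ltr1n. Qed.

Lemma le_two_powR (K : R) : K <= 2 `^ (K / ln 2).
Proof.
rewrite two_powRE mulfVK ?gt_eqF ?ln2_gt0 //.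
by apply: le_trans (expR_ge1Dx _); rewrite lerDr.
Qed.

Lemma ler_two_powR (x y : R) : x <= y -> 2 `^ x <= 2 `^ y.
Proof. by move=> xy; rewrite ler_powR // ler1n. Qed.

Lemma two_powRD (x y : R) : 2 `^ (x + y) = 2 `^ x * 2 `^ y.
Proof. by rewrite powRD // pnatr_eq0 implybT. Qed.

(** This is [2 ^ o(N)] in a form with one constant per slope, convenient for closure properties;
    [subexponential_little_o] recovers a single exponent. *)
Definition subexponential (T : Type) (N : T -> nat) (b : T -> R) : Prop :=
  forall eps, 0 < eps -> exists C, forall x, b x <= 2 `^ (eps * (N x)%:R + C).

Section Closure.
Variables (T : Type) (N : T -> nat).
Implicit Type b : T -> R.

Lemma subexponential_le b b' : (forall x, b x <= b' x) ->
  subexponential N b' -> subexponential N b.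
Proof.
move=> le_b hb' eps /hb'[C hC]; exists C => x; exact: le_trans (hC x).
Qed.

Lemma subexponential_const K : subexponential N (fun=> K).
Proof.
move=> eps eps0; exists (K / ln 2) => x; apply: le_trans (le_two_powR K) _.
by rewrite ler_two_powR // lerDr mulr_ge0 // ltW.
Qed.

Lemma subexponential_add b b' :
  subexponential N b -> subexponential N b' ->
  subexponential N (fun x => b x + b' x).
Proof.
move=> hb hb' eps eps0; have [C hC] := hb _ eps0; have [C' hC'] := hb' _ eps0.
(* The 1 in the exponent pays for having two summands. *)
exists (Num.max C C' + 1) => x.
rewrite addrA two_powRD powRr1 // mulr_natr mulr2n lerD //.
- by apply: le_trans (hC x) _; rewrite ler_two_powR // lerD2l le_max lexx.
- by apply: le_trans (hC' x) _; rewrite ler_two_powR // lerD2l le_max lexx orbT.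
Qed.

Lemma subexponential_mul b b' : (forall x, 0 <= b x) -> (forall x, 0 <= b' x) ->
  subexponential N b -> subexponential N b' ->
  subexponential N (fun x => b x * b' x).
Proof.
move=> b0 b'0 hb hb' eps eps0; have eps2 : 0 < eps / 2 by rewrite divr_gt0.
have [C hC] := hb _ eps2; have [C' hC'] := hb' _ eps2.
exists (C + C') => x; rewrite (_ : _ + _ = (eps / 2 * (N x)%:R + C) +
  (eps / 2 * (N x)%:R + C')); last by field.
by rewrite two_powRD ler_pM.
Qed.

Lemma subexponential_exp b k : (forall x, 0 <= b x) ->
  subexponential N b -> subexponential N (fun x => b x ^+ k).
Proof.
move=> b0 hb; elim: k => [|k ih].
  exact: (@subexponential_const 1).
apply: (subexponential_le (b' := fun x => b x * b x ^+ k)).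
  by move=> x; rewrite exprS.
by apply: subexponential_mul => // x; rewrite exprn_ge0.
Qed.

Lemma subexponential_linear : subexponential N (fun x => (N x).+1%:R).
Proof.
move=> eps eps0; have l2 := ln2_gt0.
(* With [u = eps * ln 2], the product [(1 + u * n) * (1 / u + 1)] is at least [n + 1], and
   [1 + u * n] is at most [2 ^ (eps * n)]. *)
pose K : R := (eps * ln 2)^-1 + 1.
exists (K / ln 2) => x; rewrite two_powRD.
have el : 0 < eps * ln 2 by rewrite mulr_gt0.
have h1 : 1 + eps * (N x)%:R * ln 2 <= 2 `^ (eps * (N x)%:R).
  by rewrite two_powRE expR_ge1Dx.
have h2 : 0 <= eps * (N x)%:R * ln 2 by rewrite !mulr_ge0 // ltW.
have K0 : 0 <= K by rewrite addr_ge0 // invr_ge0 ltW.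
apply: (@le_trans _ _ ((1 + eps * (N x)%:R * ln 2) * K)); last first.
  apply: ler_pM => //; [exact: addr_ge0|exact: le_two_powR].
rewrite /K mulrDr mulr1 -natr1 mulrDl mul1r.
have -> : eps * (N x)%:R * ln 2 * (eps * ln 2)^-1 = (N x)%:R.
  by field; rewrite !gt_eqF.
have : 0 <= (eps * ln 2)^-1 by rewrite invr_ge0 ltW.
by move: h2; lra.
Qed.

Lemma subexponential_poly c k :
  subexponential N (fun x => ((c * (N x).+1) ^ k)%:R).
Proof.
apply: (subexponential_le (b' := fun x => (c%:R * (N x).+1%:R) ^+ k)).
  by move=> x; rewrite natrX natrM.
apply: subexponential_exp => [x|]; first by rewrite mulr_ge0.
apply: subexponential_mul => //; first exact: subexponential_const.
exact: subexponential_linear.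
Qed.

Lemma subexponential_powR g c (M : T -> nat) : little_o_id g ->
  (forall x, M x <= c * (N x).+1)%N ->
  subexponential N (fun x => 2 `^ g (M x)).
Proof.
move=> go hM eps eps0.
(* A linear bound on [g] is monotone and can be evaluated at the upper bound for [M x]; the
   successor keeps the divisor nonzero. *)
have e' : 0 < eps / c.+1%:R by rewrite divr_gt0.
have [C hC] := little_o_id_le go e'.
exists (eps + C) => x; rewrite ler_two_powR // addrA.
apply: le_trans (hC _) _; rewrite lerD2r.
apply: (@le_trans _ _ (eps / c.+1%:R * (c.+1 * (N x).+1)%:R)).
  rewrite ler_wpM2l ?(ltW e') // ler_nat; apply: leq_trans (hM x) _.
  by rewrite leq_mul2r leqnSn orbT.
by rewrite natrM mulrA mulfVK // -natr1 mulrDr mulr1.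
Qed.

(** With [2 ^ t <= (c N) ^ 4] and [z = 2 ^ (t / 8)], the exponent [2 ^ f t] is
    at most [D z], hence at most [d z ^ 2 + D ^ 2 / d] for every [d > 0], and
    [z ^ 2] is linear in [N]. *)
Lemma subexponential_powR_powR f c (t : T -> nat) : little_o_id f ->
  (forall x, 2 ^ t x <= (c * (N x).+1) ^ 4)%N ->
  subexponential N (fun x => 2 `^ (2 `^ f (t x))).
Proof.
move=> fo ht eps eps0.
have e8 : 0 < (8^-1 : R) by rewrite invr_gt0.
have [C hC] := little_o_id_le fo e8.
pose D : R := 2 `^ C; pose d : R := eps / c.+1%:R.
have d0 : 0 < d by rewrite divr_gt0.
exists (eps + D ^+ 2 / d) => x; apply: ler_two_powR.
pose z : R := 2 `^ (8^-1 * (t x)%:R).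
have z0 : 0 <= z by exact: powR_ge0.
have z2 : z ^+ 2 <= c.+1%:R * (N x).+1%:R.
  rewrite -(@ler_pXn2r _ 4) ?nnegrE ?mulr_ge0 ?exprn_ge0 //.
  have -> : (z ^+ 2) ^+ 4 = (2 ^ t x)%:R.
    rewrite -exprM -powR_mulrn ?powR_ge0 // -powRrM.
    have -> : 8^-1 * (t x)%:R * (2 * 4)%:R = (t x)%:R :> R by field.
    by rewrite powR_mulrn // natrX.
  rewrite -natrM -natrX ler_nat; apply: leq_trans (ht x) _.
  by rewrite leq_exp2r // leq_mul2r leqnSn orbT.
have h1 : 2 `^ f (t x) <= D * z.
  by rewrite /D /z -two_powRD addrC ler_two_powR.
apply: (le_trans h1).
have h2 : D * z <= d * z ^+ 2 + D ^+ 2 / d.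
  have : 0 <= d * (z - D / d / 2) ^+ 2 + 3 / 4 * (D ^+ 2 / d).
    apply: addr_ge0; apply: mulr_ge0; rewrite ?sqr_ge0 ?(ltW d0) //.
    by rewrite divr_ge0 ?sqr_ge0 // ltW.
  have -> : d * (z - D / d / 2) ^+ 2 + 3 / 4 * (D ^+ 2 / d)
      = d * z ^+ 2 + D ^+ 2 / d - D * z by field; rewrite gt_eqF.
  by rewrite subr_ge0.
apply: (le_trans h2); rewrite addrA lerD2r.
apply: le_trans (ler_wpM2l (ltW d0) z2) _.
by rewrite /d mulrA mulfVK // -natr1 mulrDr mulr1.
Qed.

(** The exponent is the lower envelope of the lines with slopes [1 / (k + 1)] and intercepts [C k]:
    it lies below each line, hence is sublinear, and a bound valid for all lines passes to the
    infimum. *)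
Lemma subexponential_little_o b : subexponential N b ->
  exists2 f, little_o_id f & forall x, b x <= 2 `^ f (N x).
Proof.
move=> hb.
have hC (k : nat) : exists C : R, 0 <= C /\
    forall x, b x <= 2 `^ (k.+1%:R^-1 * (N x)%:R + C).
  have [|C hC] := hb k.+1%:R^-1; first by rewrite invr_gt0.
  (* Nonnegative intercepts keep the set of values bounded below, so that its infimum is
     meaningful. *)
  exists (Num.max 0 C); rewrite le_max lexx; split=> // x.
  by apply: le_trans (hC x) _; rewrite ler_two_powR // lerD2l le_max lexx orbT.
have [C {}hC] := choice hC.
pose B n k : R := k.+1%:R^-1 * n%:R + C k.
have B0 n k : 0 <= B n k.
  by rewrite addr_ge0 ?mulr_ge0 ?invr_ge0 //; have [] := hC k.
pose f n : R := inf (range (B n)).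
have nonempty n : (range (B n) !=set0)%classic by exists (B n 0%N); exists 0%N.
have f0 n : 0 <= f n.
  by apply: lb_le_inf => // _ [k _ <-].
have f_le n k : f n <= B n k.
  by apply: ge_inf; [exists 0 => _ [i _ <-]|exists k].
exists f.
- apply/eqoP => eps eps0.
  have e2 : 0 < eps / 2 by rewrite divr_gt0.
  pose k := Num.bound (eps / 2)^-1.
  have hk : k.+1%:R^-1 <= eps / 2.
    rewrite -[leRHS]invrK lef_pV2 ?posrE ?invr_gt0 //.
    apply: (@le_trans _ _ k%:R); last by rewrite ler_nat.
    by rewrite ltW // archi_boundP // invr_ge0 ltW.
  exists (Num.bound (C k / (eps / 2))) => // n /= hn.
  rewrite (ger0_norm (f0 n)) normr_nat; apply: le_trans (f_le n k) _.
  rewrite /B [eps in leRHS](splitr eps) mulrDl lerD ?ler_wpM2r //.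
  have [Ck0 _] := hC k.
  rewrite -ler_pdivrMl // mulrC; apply: (@le_trans _ _ (Num.bound (C k / (eps / 2)))%:R).
    by rewrite ltW // archi_boundP // divr_ge0 // ltW.
  by rewrite ler_nat.
(* A nonpositive [b x] is treated apart, as the comparison below takes its logarithm. *)
- move=> x; have [bx|bx] := leP (b x) 0; first exact: le_trans (powR_ge0 _ _).
  have ln_le k : ln (b x) / ln 2 <= B (N x) k.
    have [_ /(_ x)] := hC k; rewrite two_powRE => h.
    by rewrite ler_pdivrMr ?ln2_gt0 // -[leRHS]expRK ler_ln ?posrE ?expR_gt0.
  have : ln (b x) / ln 2 <= f (N x).
    by apply: lb_le_inf => // _ [k _ <-].
  rewrite ler_pdivrMr ?ln2_gt0 // two_powRE => h.
  by rewrite -[leLHS]lnK ?posrE // ler_expR.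
Qed.

End Closure.

End Subexponential.

(** * Assembling the lower bounds *)

Lemma ETH_no_subexponential (R : realType) (b : cnf3 -> R) (c : cmd) :
  subexponential cnf3_nvars b -> decides_in_time enc_cnf3 sat3 b c -> ~ ETH R.
Proof.
move=> /subexponential_little_o[f fo hf] dec; apply; exists c, f; split=> // G.
have [t [s [ex ans le_t]]] := dec G; exists t, s; split=> //.
exact: le_trans (hf G).
Qed.

Lemma subexponential_pap_time (R : realType) (f g : nat -> R) :
  little_o_id f -> little_o_id g ->
  subexponential cnf3_nvars (fun G => pap_time f g (ph_pap (pap_of_cnf3 G))).
Proof.
move=> fo go; apply: subexponential_mul => [G|G||]; try exact: powR_ge0.
- by apply: (subexponential_powR_powR (c := 32)) => // G; exact: pap_of_cnf3_tw.
- apply: (subexponential_powR (c := 16)) => // G.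
  by rewrite pap_of_cnf3_nvars; lia.
Qed.

Lemma subexponential_reduction_time (R : realType) k C :
  subexponential cnf3_nvars (fun G => (tsize (enc_cnf3 G) ^ k + C)%:R : R).
Proof.
apply: (subexponential_le (b' := fun G =>
    ((200 * (cnf3_nvars G).+1) ^ (4 * k))%:R + C%:R)).
  move=> G; rewrite -natrD ler_nat leq_add2r expnM.
  by case: k => // k; rewrite leq_exp2r // tsize_enc_cnf3.
apply: subexponential_add; last exact: subexponential_const.
exact: subexponential_poly.
Qed.

Lemma eq_decides (R : realType) (I : Type) (enc : I -> tree)
    (yes yes' : I -> Prop) (bound : I -> R) c :
  (forall x, yes x <-> yes' x) ->
  decides_in_time enc yes bound c -> decides_in_time enc yes' bound c.
Proof.
move=> h dec x; have [t [s [ex ans le_t]]] := dec x; exists t, s.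
by split=> //; rewrite ans.
Qed.

Lemma polytime_pap_of_cnf3 :
  polytime enc_cnf3 enc_raw_pap (reduction \o raw3).
Proof.
apply: polytime_comp polytime_reduction.
by apply: polytime_cast => G; rewrite enc_cnf3_raw3.
Qed.

Lemma polytime_pap_hyp_of_cnf3 :
  polytime enc_cnf3 (enc_pair enc_raw_pap enc_nat)
    (fun G => (reduction (raw3 G), 3%N)).
Proof. exact: polytime_pair polytime_pap_of_cnf3 (polytime_const _ _ _). Qed.

Theorem theorem5p2 (R : realType) :
  ETH R ->
  [/\ ~ (exists (c : cmd) (f g : nat -> R),
           [/\ little_o_id f, little_o_id g
             & decides_in_time enc_pap solvable_pap (pap_time f g) c]),
      ~ (exists (c : cmd) (f g : nat -> R),
           [/\ little_o_id f, little_o_id g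
             & decides_in_time enc_pap_hyp relevant
                 (fun x => pap_time f g (ph_pap x)) c])
    & ~ (exists (c : cmd) (f g : nat -> R),
           [/\ little_o_id f, little_o_id g
             & decides_in_time enc_pap_hyp necessary
                 (fun x => pap_time f g (ph_pap x)) c])].
Proof.
move=> eth; split=> -[c [f [g [fo go dec]]]]; move: eth.
- have [c' [k [C dec']]] := decides_by_reduction
    (X := fun G => ph_pap (pap_of_cnf3 G)) polytime_pap_of_cnf3
    enc_pap_of_cnf3 dec.
  apply: (ETH_no_subexponential (c := c')); last first.
    by apply: eq_decides dec' => G; have [] := pap_of_cnf3_correct G.
  apply: subexponential_add; first exact: subexponential_reduction_time.
  exact: subexponential_pap_time.
- have [c' [k [C dec']]] := decides_by_reduction
    polytime_pap_hyp_of_cnf3 enc_pap_hyp_of_cnf3 dec.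
  apply: (ETH_no_subexponential (c := c')); last first.
    by apply: eq_decides dec' => G; have [] := pap_of_cnf3_correct G.
  apply: subexponential_add; first exact: subexponential_reduction_time.
  exact: subexponential_pap_time.
- have [c1 [k [C dec1]]] := decides_by_reduction
    polytime_pap_hyp_of_cnf3 enc_pap_hyp_of_cnf3 dec.
  (* Necessity expresses unsatisfiability. Flipping the answer decides the double negation of
     [sat3], which classical logic removes. *)
  have [c' dec'] := decides_negation dec1.
  apply: (ETH_no_subexponential (c := c')); last first.
    apply: eq_decides dec' => G; have [_ _ ->] := pap_of_cnf3_correct G.
    by split=> [/contrapT|h /(_ h)].
  apply: subexponential_add; first exact: subexponential_const.
  apply: subexponential_add; first exact: subexponential_reduction_time.
  exact: subexponential_pap_time.
Qed.
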